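(* Let $B_1(0)$ be the unit disc in $\mathbb{R}^2$ and let $f\in W^{1,1}(B_1(0)\times[0,1];\mathbb{R}^3)$ be an axially symmetric, orientation preserving, cylindrical product function of the form $$f(r\cos\theta,r\sin\theta,z)=\bigl(w(z)v(r)\cos(g(\theta)),\;w(z)v(r)\sin(g(\theta)),\;h(z)l(r)\bigr)$$ for some real-valued functions $w,v,g,h,l$. Assume that each of the functions $w,v,h,l$ is monotonic (non-decreasing or non-increasing), that $g$ is non-decreasing, and that each of $w$ and $h$ is either concave or convex. If $f(B_1(0)\times\{0\})$ consists of a single point, then $$\int_{B_1(0)\times[0,1]}\frac{\|\nabla f\|^3}{\det(\nabla f)}\,dx=\infty .$$
   Context: $(r,\theta,z)$ are cylindrical polar coordinates on $\mathbb{R}^3$. Let $R_\theta$ denote rotation by angle $\theta$ about the $z$-axis. A set $\Omega\subset\mathbb{R}^3$ is axially symmetric if $R_\theta\Omega=\Omega$ for every $\theta$; a function $f:\Omega\to\mathbb{R}^3$ on an axially symmetric set is axially symmetric if $f(S)$ is axially symmetric for every axially symmetric subset $S\subset\Omega$. A function $G:\Omega\to\mathbb{R}$ is a cylindrical product function if $G(r\cos\theta,r\sin\theta,z)=p_1(r)p_2(\theta)p_3(z)$ for some functions $p_1,p_2,p_3$; $f:\Omega\to\mathbb{R}^3$ is a cylindrical product function if each coordinate function is. Orientation preserving means $\det(\nabla f)>0$ a.e. $\|\cdot\|$ is the operator (sup) norm on matrices. The values of the Sobolev function $f$ on the end $B_1(0)\times\{0\}$ are understood in the sense of traces. *)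

(* Defs.v *)
From mathcomp Require Import all_boot all_order all_algebra.
From mathcomp Require Import all_classical all_reals all_analysis.

Set Implicit Arguments.
Unset Strict Implicit.
Unset Printing Implicit Defensive.

Import Order.TTheory GRing.Theory Num.Theory.
Import numFieldNormedType.Exports.

Local Open Scope classical_set_scope.
Local Open Scope ring_scope.

(* Points of R^3 are triples [(x, y, z) : R * R * R].  The product topology is
   the Euclidean one, but the library norm on triples is the sup norm; it is
   never used below as a metric quantity. *)

Notation leb2 R := (@lebesgue_measure R \x @lebesgue_measure R)%E.
Notation leb3 R :=
  (@lebesgue_measure R \x @lebesgue_measure R \x @lebesgue_measure R)%E.

Definition coord3 {R : realType} (i : 'I_3) (p : R * R * R) : R :=
  tnth [tuple p.1.1; p.1.2; p.2] i.

Definition basis3 {R : realType} (i : 'I_3) : R * R * R :=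
  ((i == 0)%:R, (i == 1)%:R, (i == 2)%:R).

Definition disc (R : realType) : set (R * R) :=
  [set q | q.1 ^+ 2 + q.2 ^+ 2 < 1].
Arguments disc : clear implicits.

Definition cylinder (R : realType) : set (R * R * R) :=
  disc R `*` [set` `[0, 1]].
Arguments cylinder : clear implicits.

Definition rotz {R : realType} (t : R) (p : R * R * R) : R * R * R :=
  (cos t * p.1.1 - sin t * p.1.2, sin t * p.1.1 + cos t * p.1.2, p.2).

Definition axisymmetric_set {R : realType} (S : set (R * R * R)) :=
  forall t, rotz t @` S = S.

Definition axisymmetric_fun {R : realType} (D : set (R * R * R))
    (f : R * R * R -> R * R * R) :=
  forall S, S `<=` D -> axisymmetric_set S -> axisymmetric_set (f @` S).

(* The polar chart is r > 0, 0 <= theta < 2 pi: every point off the z-axis has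
   exactly one such pair (r, theta), and nothing is required on the axis, where
   theta is undefined. *)
Definition cylindrical_product {R : realType} (D : set (R * R * R))
    (G : R * R * R -> R) :=
  exists p1 p2 p3 : R -> R, forall r theta z,
    0 < r -> theta \in `[0, 2 * pi[ -> D (r * cos theta, r * sin theta, z) ->
    G (r * cos theta, r * sin theta, z) = p1 r * p2 theta * p3 z.

Definition monotonic_on {R : realType} (I : interval R) (u : R -> R) :=
  {in I &, nondecreasing_fun u} \/ {in I &, nonincreasing_fun u}.

Definition convex_on {R : realType} (I : interval R) (u : R -> R) :=
  @convex_function R R^o [set` I] u.

Definition concave_on {R : realType} (I : interval R) (u : R -> R) :=
  convex_on I (fun x => - u x).

Definition enorm {R : realType} n (x : 'cV[R]_n) : R :=
  Num.sqrt (\sum_(i < n) x i 0 ^+ 2).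

Definition opnorm {R : realType} n (A : 'M[R]_n) : R :=
  sup [set enorm (A *m x) | x in [set x : 'cV[R]_n | enorm x <= 1]].

Fixpoint Ck {R : realType} (k : nat) (u : R * R * R -> R) : Prop :=
  continuous u /\
  if k is k'.+1 then
    forall j : 'I_3, (forall x, derivable u x (basis3 j)) /\
                     Ck k' (fun x => 'D_(basis3 j) u x)
  else True.

Definition smooth {R : realType} (u : R * R * R -> R) := forall k, Ck k u.

Definition test_function {R : realType} (U : set (R * R * R))
    (phi : R * R * R -> R) :=
  let supp := closure [set x | phi x != 0] in
  [/\ smooth phi, compact supp & supp `<=` U].

(* [W11 U f Df]: on the open set U, f is in W^{1,1}(U; R^3) and Df is a weak
   gradient of f, with [Df x i j] the weak partial derivative d f_i / d x_j. *)
Definition W11 {R : realType} (U : set (R * R * R))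
    (f : R * R * R -> R * R * R) (Df : R * R * R -> 'M[R]_3) :=
  [/\ forall i, (leb3 R).-integrable U (fun x => (coord3 i (f x))%:E),
      forall i j, (leb3 R).-integrable U (fun x => (Df x i j)%:E) &
      forall i j phi, test_function U phi ->
        \int[leb3 R]_(x in U) (coord3 i (f x) * 'D_(basis3 j) phi x) =
        - \int[leb3 R]_(x in U) (Df x i j * phi x)].

(* [base_trace f Df T]: T is the trace of f on the end z = 0 of the cylinder,
   for f in W^{1,1} with weak gradient Df.  The trace operator is the continuous
   extension to W^{1,1} of the restriction of smooth functions, so T is the L^1
   limit on the disc of restrictions of functions, smooth up to the boundary,
   that converge to f in W^{1,1}. *)
Definition base_trace {R : realType} (f : R * R * R -> R * R * R)
    (Df : R * R * R -> 'M[R]_3) (T : R * R -> R * R * R) :=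
  forall i : 'I_3,
    (leb2 R).-integrable (disc R) (fun q => (coord3 i (T q))%:E) /\
    exists u : nat -> R * R * R -> R,
      [/\ forall n, smooth (u n),
          (\int[leb3 R]_(x in (cylinder R)°) `|u n x - coord3 i (f x)|%:E)%E
            @[n --> \oo] --> 0%E,
          forall j, (\int[leb3 R]_(x in (cylinder R)°)
              `|'D_(basis3 j) (u n) x - Df x i j|%:E)%E
            @[n --> \oo] --> 0%E &
          (\int[leb2 R]_(q in disc R) `|u n (q, 0%R) - coord3 i (T q)|%:E)%E
            @[n --> \oo] --> 0%E].

Definition orientation_preserving {R : realType} (D : set (R * R * R))
    (Df : R * R * R -> 'M[R]_3) :=
  {ae leb3 R, forall x, D x -> 0 < \det (Df x)}.

(* Main.v *)
Require Import Defs.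
From HB Require Import structures.
From mathcomp Require Import all_boot all_order all_algebra.
From mathcomp Require Import all_classical all_reals all_analysis.
From mathcomp Require Import measurable_realfun.
From mathcomp Require Import ring lra.

(* Work on a box Q x ]0, 1[ in the first quadrant, chosen so that v and l each
   vanish nowhere or everywhere on it; there every component of f has the form
   W(z) V(q).
   Since f is approximated by smooth functions in W^{1,1} and its trace is the
   point p, for almost every q one has f(q, z) = p + int_0^z df/dz(q, .) for
   almost every z, and comparing two heights shows that the horizontal partial
   derivatives also have the form W(z) A(q).
   Letting z tend to 0, either p_i = 0 or the component f_i does not depend on q;
   the latter is impossible for the first two components because det > 0.
   Hence, with s = |df/dz| and S(z) = int_0^z s, the two horizontal columns of
   the gradient are bounded by C(q) S(z).  Since the determinant is at most the
   product of the l^1 norms of the columns, the energy density dominates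
   c(q) (s/S)^2, and s/S is never integrable near 0: the integral of s over
   ]0, e[ equals S(e), so that of s/S is at least 1 for every e. *)

Set Implicit Arguments.
Unset Strict Implicit.
Unset Printing Implicit Defensive.

Import Order.TTheory GRing.Theory Num.Theory.
Import numFieldNormedType.Exports.

Local Open Scope classical_set_scope.
Local Open Scope ring_scope.

(** No derivative of w, v, g, h or l is ever computed: the weak gradient of f is reached only
    through the approximating smooth functions, and the product form enters as an algebraic relation
    between slices. For a component W V the combination W(z1) f_i(., z2) - W(z2) f_i(., z1) is zero,
    so its weak horizontal derivatives vanish; this passes the factor W on to them without any
    regularity of V. The bound of the horizontal columns by S comes from the case W(0+) = 0: then
    p_i = 0 and W(z) V(q) is the vertical integral of df_i/dz, whence |W| <= S / |V|. The first two
    components share W, so one nonzero V among them controls both rows. If the energy were finite,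
    an integrable rho with s^3 <= rho det would exist. Together with det <= C^2 S^2 s this gives s^2
    <= C^2 rho S^2, and s <= (1 + C^2 rho) S on almost every vertical line, against the divergence
    of the integral of s/S. *)

(** * Almost everywhere arguments and measurability in R^3 *)

(* The infimum of the k n has integral 0: this replaces the extraction of an
   almost everywhere convergent subsequence. *)
Lemma ae_arbitrarily_small d (T : measurableType d) (R : realType)
    (mu : {measure set T -> \bar R}) (k : nat -> T -> \bar R) :
  (forall n, measurable_fun setT (k n)) -> (forall n t, 0 <= k n t)%E ->
  (forall e : R, 0 < e -> exists n, (\int[mu]_t k n t < e%:E)%E) ->
  {ae mu, forall t, forall e : R, 0 < e -> exists n, (k n t < e%:E)%E}.
Proof.
move=> mk k0 ke; pose g t := einfs (k ^~ t) 0.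
have g0 t : (0 <= g t)%E by apply: le_ereal_inf_tmp => _ [n _ <-]; exact: k0.
have mg : measurable_fun setT g by exact: measurable_fun_einfs.
have gk n t : (g t <= k n t)%E by apply: ereal_inf_lbound; exists n.
have ig : (\int[mu]_t `|g t| = 0)%E.
  apply/eqP; rewrite eq_le integral_ge0 ?andbT//; apply/lee_addgt0Pr => e e0.
  rewrite add0e; have [n /ltW] := ke e e0; apply: le_trans.
  by apply: ge0_le_integral => //= [|t _];
    [exact: measurableT_comp|rewrite gee0_abs].
have := (ae_eq_integral_abs mu measurableT mg).1 ig.
apply: filterS => t /(_ I) /= gt0 e e0.
have /ereal_inf_lt[_ [n _ <-] kn] : (g t < e%:E)%E by rewrite gt0 lte_fin.
by exists n.
Qed.

(** The product measure of a null set is the integral of the measures of its sections, so almost all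
    sections are null. *)
Lemma ae_xsection d1 d2 (T1 : measurableType d1) (T2 : measurableType d2)
    (R : realType) (m1 : {sigma_finite_measure set T1 -> \bar R})
    (m2 : {sigma_finite_measure set T2 -> \bar R}) (P : T1 * T2 -> Prop) :
  {ae (m1 \x m2)%E, forall p, P p} ->
  {ae m1, forall x, {ae m2, forall y, P (x, y)}}.
Proof.
move=> [N [mN N0 PN]].
have : (\int[m1]_x `|(m2 \o xsection N) x| = 0)%E.
  by rewrite -[RHS]N0; apply: eq_integral => x _; rewrite gee0_abs.
move/(ae_eq_integral_abs m1 measurableT (measurable_fun_xsection m2 mN)).1.
apply: filterS => x /(_ I) /= Nx; exists (xsection N x); split => //.
  exact: measurable_xsection.
by move=> y Py; rewrite xsectionE/=; exact: PN.
Qed.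

(** These balls form a countable base of the line, from which open sets of R^3 become countable
    unions of measurable boxes. *)
Lemma ball_rat (R : realType) (x e : R) : 0 < e ->
  exists p : rat * nat, ball (ratr p.1 : R) p.2.+1%:R^-1 x /\
    ball (ratr p.1 : R) p.2.+1%:R^-1 `<=` ball x e.
Proof.
(* This [n] makes 1/(n+1) < e/2, so a ball of radius 1/(n+1) that contains [x] lies within [e] of
   [x]. *)
move=> e0; pose n := Num.truncn (2 / e).
have ne : n.+1%:R^-1 < e / 2.
  by rewrite invf_plt ?posrE ?ltr0n ?divr_gt0// invf_div truncnS_gt.
have n0 : 0 < n.+1%:R^-1 :> R by rewrite invr_gt0.
have xn : x - n.+1%:R^-1 < x by rewrite ltrBlDr ltrDl.
have [q] := rat_in_itvoo xn.
rewrite in_itv/= => /andP[q1 q2]; exists (q, n); rewrite /ball/=.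
move: (ratr q) (n.+1%:R^-1) q1 q2 ne n0 => c k *.
split; first by rewrite ltr_norml; apply/andP; split; lra.
by move=> y; rewrite /ball/= !ltr_norml => /andP[*]; apply/andP; split; lra.
Qed.

(* Measurability is stated over [measurableTypeR R], which carries Lebesgue
   measure; [R] itself has a convertible structure with another display. *)
Lemma open3_measurable (R : realType) (A : set (R * R * R)) :
  open A -> measurable (A : set (measurableTypeR R * measurableTypeR R *
      measurableTypeR R)).
Proof.
move=> oA.
pose b (p : rat * nat) : set R := ball (ratr p.1 : R) p.2.+1%:R^-1.
pose B (t : (rat * nat) * (rat * nat) * (rat * nat)) := b t.1.1 `*` b t.1.2 `*`
    b t.2.
have -> : A = \bigcup_(t in [set t | B t `<=` A]) B t.
  apply/seteqP; split => [[[x y] z] Axyz|p [t tA tp]]; last exact: tA.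
  have /nbhs_ballP[e /= e0 eA] : nbhs (x, y, z) A by exact: open_nbhs_nbhs.
  have [p [px pe]] := ball_rat x e0.
  have [q [qy qe]] := ball_rat y e0.
  have [r [rz re]] := ball_rat z e0.
  exists (p, q, r) => //=.
  move=> [[x' y'] z'] [[/= x'p y'q] z'r]; apply: eA; split; last exact: re.
  by split; [exact: pe|exact: qe].
rewrite bigcup_mkcond; apply: countable_bigcupT_measurable => // t; case: ifP
    => // _.
have mb p : measurable (b p : set (measurableTypeR R)) by exact:
    measurable_ball.
by apply: measurableX => //; exact: measurableX.
Qed.

Lemma continuous3_measurable (R : realType) (u : R * R * R -> R) :
  continuous u ->
  measurable_fun
    [set: measurableTypeR R * measurableTypeR R * measurableTypeR R] u.
Proof.
move=> cu; apply: (measurability _ (RGenOpens.measurableE R)).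
move=> _ [_ [a [b ->]] <-]; rewrite setTI; apply: open3_measurable.
by apply: open_comp => // x _; exact: cu.
Qed.

Lemma ae_arbitrarily_small_in d (T : measurableType d) (R : realType)
    (mu : {measure set T -> \bar R}) (D : set T) (k : nat -> T -> \bar R) :
  measurable D -> (forall n, measurable_fun D (k n)) ->
  (forall n t, 0 <= k n t)%E ->
  (forall e : R, 0 < e -> exists n, (\int[mu]_(t in D) k n t < e%:E)%E) ->
  {ae mu, forall t, D t -> forall e : R, 0 < e -> exists n, (k n t < e%:E)%E}.
Proof.
move=> mD mk k0 ke.
have := @ae_arbitrarily_small _ _ _ mu (fun n => k n \_ D).
case.
- by move=> n; apply/(measurable_restrictT (k n) mD).
- by move=> n t; apply: erestrict_ge0 => // x _; exact: k0.
- by move=> e /ke[n ne]; exists n; rewrite -integral_mkcond.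
move=> N [mN N0 kN]; exists N; split => //; apply: subset_trans kN => t /=.
apply: contra_not => kt Dt e /kt[n]; rewrite patchE mem_set// => kn.
by exists n.
Qed.

Lemma ae_and d (T : measurableType d) (R : realType)
    (mu : {measure set T -> \bar R}) (P Q : T -> Prop) :
  {ae mu, forall t, P t} -> {ae mu, forall t, Q t} ->
  {ae mu, forall t, P t /\ Q t}.
Proof. exact: filterI. Qed.

Lemma ae_imp d (T : measurableType d) (R : realType)
    (mu : {measure set T -> \bar R}) (P Q : T -> Prop) :
  (forall t, P t -> Q t) -> {ae mu, forall t, P t} -> {ae mu, forall t, Q t}.
Proof. exact: filterS. Qed.

Lemma ae_andD d (T : measurableType d) (R : realType)
    (mu : {measure set T -> \bar R}) (D : set T) (P Q : T -> Prop) :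
  {ae mu, forall t, D t -> P t} -> {ae mu, forall t, D t -> Q t} ->
  {ae mu, forall t, D t -> P t /\ Q t}.
Proof.
by move=> aP aQ; apply: ae_imp (ae_and aP aQ) => t [tP tQ] Dt; split; auto.
Qed.

Lemma ae_ex d (T : measurableType d) (R : realType)
    (mu : {measure set T -> \bar R}) (D : set T) (P : T -> Prop) :
  measurable D -> (mu D != 0)%E -> {ae mu, forall t, D t -> P t} ->
  exists2 t, D t & P t.
Proof.
move=> mD D0 [N [mN N0 PN]]; apply: contrapT => nP.
move/eqP: D0; apply; apply: (subset_measure0 _ _ _ N0) => // t Dt.
by apply: PN => /= DP; apply: nP; exists t => //; exact: DP.
Qed.

Lemma ae_ex_itv (R : realType) (a b : R) (P : R -> Prop) : a < b ->
  {ae (@lebesgue_measure R), forall t, t \in `]a, b[ -> P t} ->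
  exists2 t, t \in `]a, b[ & P t.
Proof.
move=> ab Pae.
have ab0 : (@lebesgue_measure R `]a, b[ != 0)%E.
  by rewrite lebesgue_measure_itv/= lte_fin ab -EFinD eqe subr_eq0 gt_eqF.
exact: (@ae_ex _ _ _ (@lebesgue_measure R) `]a, b[%classic P (measurable_itv _)
    ab0 Pae).
Qed.

(** * Increments of C^1 functions and weak derivatives of constants in one variable *)

Lemma C1_increment (R : realType) (u u' : R -> R) (s t : R) : s < t ->
  (forall x : R, is_derive x 1 u (u' x)) -> continuous u' ->
  u t - u s = \int[lebesgue_measure]_(x in `]s, t]) u' x.
Proof.
move=> st du cu.
have uc x : {for x, continuous u}.
  by apply: differentiable_continuous; apply/derivable1_diffP; case: (du x).
have cuw : {within `[s, t], continuous u'} by exact: continuous_subspaceT.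
rewrite Rintegral_itv_obnd_cbnd; last first.
  have := continuous_compact_integrable (@segment_compact _ s t) cuw.
  by apply: integrableS => //; exact: subset_itv_oc_cc.
rewrite /Rintegral (@continuous_FTC2 _ u' u)//.
- by split => [x _| |]; [case: (du x)|apply: cvg_at_right_filter; exact: uc|
    apply: cvg_at_left_filter; exact: uc].
- by move=> x _; rewrite derive1E; case: (du x).
Qed.

(** Enlarging the domain of the error from ]s, t] to [D] makes the bound independent of the
    endpoints. *)
Lemma C1_increment_error (R : realType) (u u' h : R -> R) (s t : R)
    (D : set (measurableTypeR R)) : s < t -> measurable D -> `]s, t] `<=` D ->
  (forall x : R, is_derive x 1 u (u' x)) -> continuous u' ->
  lebesgue_measure.-integrable D (EFin \o h) ->
  (`|u t - u s - \int[lebesgue_measure]_(x in `]s, t]) h x|%:E <=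
    \int[lebesgue_measure]_(x in D) `|u' x - h x|%:E)%E.
Proof.
move=> st mD stD du cu ih.
have ihs : lebesgue_measure.-integrable `]s, t] (EFin \o h).
  by apply: integrableS ih.
have iu : lebesgue_measure.-integrable `]s, t] (EFin \o u').
  have := continuous_compact_integrable (@segment_compact _ s t)
    (continuous_subspaceT cu).
  by apply: integrableS => //; exact: subset_itv_oc_cc.
rewrite (C1_increment st du cu) -RintegralB// EFin_normr_Rintegral//; last
    first.
  have mst : measurable (`]s, t] : set (measurableTypeR R)).
    exact: measurable_itv.
  exact: (integrableB mst iu ihs).
have mu' : measurable_fun setT u' by exact: continuous_measurable_fun.
have mh : measurable_fun D h.
  by have /integrableP[/measurable_EFinP] := ih.
have md : measurable_fun D (fun x => (`|u' x - h x|)%:E).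
  apply/measurable_EFinP; apply: measurableT_comp => //.
  by apply: measurable_funB => //; exact: measurable_funTS.
apply: (le_trans (le_abse_integral _ _ _)) => //.
  apply/measurable_EFinP; apply: measurable_funB.
    exact: measurable_funTS.
  exact: measurable_funS mh.
by apply: ge0_subset_integral.
Qed.

(** A term constant in t contributes [k n * m] to the integral, which stays small because [D] has
    finite measure. Keeping it beside [v n] ensures that one index makes both terms small. *)
Lemma ae_arbitrarily_small_cst d (T : measurableType d) (R : realType)
    (mu : {measure set T -> \bar R}) (D : set T) (k : nat -> \bar R)
    (v : nat -> T -> \bar R) (m : R) :
  measurable D -> mu D = m%:E -> (forall n, measurable_fun D (v n)) ->
  (forall n, 0 <= k n)%E -> (forall n t, 0 <= v n t)%E ->
  (forall e : R, 0 < e -> exists n, (k n + \int[mu]_(t in D) v n t < e%:E)%E) ->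
  {ae mu, forall t, D t ->
    forall e : R, 0 < e -> exists n, (k n + v n t < e%:E)%E}.
Proof.
move=> mD Dm mv k0 v0 kv.
have m0 : 0 <= m by rewrite -lee_fin -Dm.
apply: ae_arbitrarily_small_in => //.
- by move=> n; exact: emeasurable_funD.
- by move=> n t; rewrite adde_ge0.
move=> e e0; have m1 : 0 < m + 1 by rewrite ltr_wpDl.
(* Dividing by m + 1 covers m = 0, and x m + y <= (x + y)(m + 1) for nonnegative x, y, m. *)
have /kv[n ne] : 0 < e / (m + 1) by rewrite divr_gt0.
exists n; rewrite ge0_integralD//.
rewrite [X in (X + _)%E](_ : _ = k n * m%:E)%E; last first.
  by rewrite -Dm -(integral_cst mu mD).
have iv0 : (0 <= \int[mu]_(t in D) v n t)%E by exact: integral_ge0.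
have kfin : (k n < +oo)%E.
  by apply: le_lt_trans (lt_trans ne (ltry _)); rewrite leeDl.
have ivfin : (\int[mu]_(t in D) v n t < +oo)%E.
  by apply: le_lt_trans (lt_trans ne (ltry _)); rewrite leeDr.
move: ne (k0 n) iv0 kfin ivfin.
case: (k n) => // x; case: (integral _ _ _) => // y.
rewrite -EFinM -!EFinD !lte_fin !lee_fin ltr_pdivlMr// => + x0 y0 _ _.
by apply: le_lt_trans; nra.
Qed.

(** Equal values are asked only at points arbitrarily close on the right, because the primitive to
    which this is applied is constant only almost everywhere. *)
Lemma derive_eq0_of_equal_values (R : realType) (F : R -> R) (x : R) :
  derivable F x 1 ->
  (forall d : R, 0 < d -> exists2 s, s \in `]x, x + d[ & F s = F x) ->
  'D_1 F x = 0.
Proof.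
move=> dF eqF; apply/eqP/negP => /negP nz.
have dF2 : (fun y => y^-1 *: (F (y *: (1 : R) + x) - F x)) @ 0^' --> 'D_1 F x
    by exact: dF.
have : nbhs (0 : R)^' [set y | y^-1 *: (F (y *: (1 : R) + x) - F x) != 0].
  exact: (cvgr_neq0 _ dF2 nz).
move=> /nbhs_ballP[e /= e0 ne]; have [s] := eqF e e0.
rewrite in_itv/= => /andP[xs sxe] Fs.
have := ne (s - x); rewrite /ball/= sub0r normrN gtr0_norm ?subr_gt0//.
have sx : s - x < e by rewrite ltrBlDl.
move=> /(_ sx); rewrite subr_eq0 gt_eqF// => /(_ isT) /eqP; apply.
by rewrite /= [(s - x) *: _]mulr1 subrK Fs subrr scaler0.
Qed.

(* Uniqueness of weak derivatives of constants: the primitive of h is almost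
   everywhere constant, hence h = 0 by Lebesgue differentiation. *)
Lemma ae_eq0_of_small_primitive (R : realType) (a b c : R)
    (u u' : nat -> R -> R) (h : R -> R) : a < b ->
  (forall n (x : R), is_derive x 1 (u n) (u' n x)) ->
  (forall n, continuous (u' n)) ->
  lebesgue_measure.-integrable setT (EFin \o h) ->
  (forall e : R, 0 < e -> exists n,
    (\int[lebesgue_measure]_(x in `]a, b[)
      (`|u n x - c| + `|u' n x - h x|)%:E < e%:E)%E) ->
  {ae @lebesgue_measure R, forall x, x \in `]a, b[ -> h x = 0}.
Proof.
move=> ab du cu ih small.
pose I : set (measurableTypeR R) := `]a, b[%classic.
have mI : measurable I by exact: measurable_itv.
have Iba : @lebesgue_measure R I = (b - a)%:E.
  by rewrite lebesgue_measure_itv/= lte_fin ab -EFinD.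
have uc n : continuous (u n).
  move=> x; apply: differentiable_continuous; apply/derivable1_diffP.
  by case: (du n x).
have mh : measurable_fun setT (h : measurableTypeR R -> R).
  by have /integrableP[/measurable_EFinP] := ih.
have mu1 n : measurable_fun setT (u n : measurableTypeR R -> R).
  exact: continuous_measurable_fun.
have mu2 n : measurable_fun setT (u' n : measurableTypeR R -> R).
  exact: continuous_measurable_fun.
pose v n (x : measurableTypeR R) := `|u n x - c|%:E.
pose v' n (x : measurableTypeR R) := `|u' n x - h x|%:E.
pose k n := (\int[lebesgue_measure]_(x in I) (v n x + v' n x))%E.
have mv n : measurable_fun I (v n).
  apply/measurable_EFinP; apply: measurableT_comp => //.
  by apply: measurable_funB => //; exact: measurable_funTS.
have mv' n : measurable_fun I (v' n).
  apply/measurable_EFinP; apply: measurableT_comp => //.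
  by apply: measurable_funB => //; exact: measurable_funTS.
have v0 n x : (0 <= v n x)%E by rewrite lee_fin.
have v'0 n x : (0 <= v' n x)%E by rewrite lee_fin.
have k0 n : (0 <= k n)%E by apply: integral_ge0 => x _; rewrite adde_ge0.
have kE n : k n = (\int[lebesgue_measure]_(x in I) v n x +
    \int[lebesgue_measure]_(x in I) v' n x)%E by rewrite /k ge0_integralD.
have iv0 n : (0 <= \int[lebesgue_measure]_(x in I) v n x)%E.
  exact: integral_ge0.
have iv'0 n : (0 <= \int[lebesgue_measure]_(x in I) v' n x)%E.
  exact: integral_ge0.
have ivk n : (\int[lebesgue_measure]_(x in I) v n x <= k n)%E.
  by rewrite kE leeDl.
have iv'k n : (\int[lebesgue_measure]_(x in I) v' n x <= k n)%E.
  by rewrite kE leeDr.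
pose F x := \int[lebesgue_measure]_(t in `]-oo, x]) h t.
(* The increments of [F] and [u n] differ by at most the L^1 distance of [h] and [u' n], and [u n]
   is within [v n] of [c] at both endpoints. *)
have incr n : forall s t, s \in `]a, b[ -> t \in `]a, b[ ->
    (`|F s - F t|%:E <= k n + v n s + v n t)%E.
  suff lt_incr s t : s \in `]a, b[ -> t \in `]a, b[ -> s < t ->
      (`|F t - F s|%:E <= k n + v n s + v n t)%E.
    move=> s t sI tI; have [st|ts|<-] := ltgtP s t.
    - by rewrite distrC; exact: lt_incr.
    - by rewrite -addeA [(v _ _ + _)%E]addeC addeA; exact: lt_incr.
    - by rewrite subrr normr0; do 2?apply: adde_ge0.
  rewrite !in_itv/= => /andP[aS sb] /andP[aT tb] st.
  have stI : `]s, t] `<=` I.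
    move=> x; rewrite /I /= !in_itv/= => /andP[sx xt].
    by rewrite (lt_trans aS)//= (le_lt_trans xt).
  have ihI : lebesgue_measure.-integrable I (EFin \o h).
    exact: integrableS ih.
  have := C1_increment_error st mI stI (du n) (cu n) ihI.
  move=> /le_trans/(_ (iv'k n)).
  rewrite /F Rintegral_itvB//; [|exact: integrableS ih|by rewrite bnd_simp ltW].
  move: (\int[_]_(_ in _) _) => z kz.
  have : (`|z|%:E <= `|u n t - u n s - z|%:E + v n s + v n t)%E.
    rewrite /v -!EFinD lee_fin.
    have -> : z = (u n t - c) - (u n s - c) - (u n t - u n s - z) by ring.
    have -> : u n t - u n s - ((u n t - c) - (u n s - c) -
      (u n t - u n s - z)) = u n t - u n s - z by ring.
    have := ler_normB (u n t - c - (u n s - c)) (u n t - u n s - z).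
    have := ler_normB (u n t - c) (u n s - c); lra.
  by move=> /le_trans; apply; rewrite leeD2r// leeD2r.
have [t0 t0I t0small] : exists2 t0, t0 \in `]a, b[ &
    forall e : R, 0 < e -> exists n, (k n + v n t0 < e%:E)%E.
  apply: ae_ex_itv => //.
  apply: (@ae_arbitrarily_small_cst _ _ _ _ I k v (b - a)) => // e e0.
  have /small[n ne] : 0 < e / 2 by rewrite divr_gt0.
  exists n; rewrite (splitr e) EFinD lteD//.
  by rewrite (le_lt_trans (ivk n)).
have Fcst : {ae @lebesgue_measure R, forall s, s \in `]a, b[ -> F s = F t0}.
  (* The error at [t0] joins the constant term, so that one index [n] serves both [s] and [t0]. *)
  have : {ae @lebesgue_measure R, forall s, I s ->
      forall e : R, 0 < e -> exists n, ((k n + v n t0) + v n s < e%:E)%E}.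
    apply: (@ae_arbitrarily_small_cst _ _ _ _ I _ v (b - a)) => //.
      by move=> n; exact: adde_ge0.
    move=> e e0; have /t0small[n ne] : 0 < e / 2 by rewrite divr_gt0.
    exists n; rewrite (splitr e) EFinD lteD//.
    by rewrite (le_lt_trans (ivk n))// (le_lt_trans _ ne)// leeDl.
  apply: ae_imp => s sI sab; apply/eqP; rewrite -subr_eq0 -normr_le0.
  apply/ler_addgt0Pr => e /(sI sab)[n ne]; rewrite add0r.
  rewrite -lee_fin; apply: ltW; apply: le_lt_trans ne.
  by rewrite -addeA [(v _ _ + _)%E]addeC addeA; exact: incr.
have Fder : {ae @lebesgue_measure R, forall x, derivable F x 1 /\ F^`()%classic
    x = h x}.
  apply: FTC1Ny; first by move=> y; exact: integrableS ih.
  by apply: open_integrable_locally => //; exact: openT.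
apply: ae_imp (ae_and Fcst Fder) => x [Fx [dF F'x]] xI.
rewrite -F'x derive1E; apply: derive_eq0_of_equal_values => // d d0.
move: (xI); rewrite in_itv/= => /andP[ax xb].
have xm : x < Num.min (x + d) b by rewrite lt_min ltrDl d0.
have [s] : exists2 s, s \in `]x, Num.min (x + d) b[ & s \in `]a, b[ -> F s = F
    t0.
  by apply: ae_ex_itv => //; apply: ae_imp Fcst => s sF _.
rewrite in_itv/= lt_min => /and3P[xs sxd sb] Fs; exists s.
  by rewrite in_itv/= xs.
by rewrite Fs ?Fx// in_itv/= sb (lt_trans ax).
Qed.

(** * Tonelli on rectangles and derivatives along slices *)

Section product_sigma_finite.
Context d1 d2 (T1 : measurableType d1) (T2 : measurableType d2) (R : realType).
Variables (m1 : {sigma_finite_measure set T1 -> \bar R})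
  (m2 : {sigma_finite_measure set T2 -> \bar R}).
Lemma sigma_finite_prod : sigma_finite setT (m1 \x m2)%E.
Proof.
have /sigma_finiteP[F [TF ndF Foo]] := sigma_finiteT m1.
have /sigma_finiteP[G [TG ndG Goo]] := sigma_finiteT m2.
exists (fun n => F n `*` G n).
  rewrite -setXTT TF TG; apply/seteqP; split => [[x y] [/= [n _ Fx] [k _ Gy]]|].
    exists (maxn n k) => //; split.
    - by move: x Fx; exact/subsetPset/ndF/leq_maxl.
    - by move: y Gy; exact/subsetPset/ndG/leq_maxr.
  by move=> [x y] [n _ [Fx Gy]]; split; exists n.
move=> k; have [? ?] := Foo k; have [? ?] := Goo k.
split; first exact: measurableX.
by rewrite product_measure1E// lte_mul_pinfty// ge0_fin_numE.
Qed.

(* The canonical sigma-finite structure found on [m1 \x m2] only applies to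
   subprobabilities. *)
Definition prod_sf : {sigma_finite_measure set (T1 * T2)%type -> \bar R} :=
  HB.pack_for {sigma_finite_measure set (T1 * T2)%type -> \bar R} (m1 \x m2)%E
   (Measure.on (m1 \x m2)%E)
   (Measure_isSigmaFinite.Build _ _ _ (m1 \x m2)%E sigma_finite_prod).
End product_sigma_finite.

Definition lebs (R : realType) : {sigma_finite_measure set _ -> \bar R} :=
  [the {sigma_finite_measure set _ -> \bar R} of @lebesgue_measure R].

Definition leb2s (R : realType) := prod_sf (lebs R) (lebs R).

Section rectangle.
Context d1 d2 (T1 : measurableType d1) (T2 : measurableType d2) (R : realType).
Variables (m1 : {sigma_finite_measure set T1 -> \bar R})
  (m2 : {sigma_finite_measure set T2 -> \bar R}).
Variables (A : set T1) (B : set T2) (g : T1 * T2 -> \bar R).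
Hypotheses (mA : measurable A) (mB : measurable B)
  (mg : measurable_fun (A `*` B) g) (g0 : forall p, (0 <= g p)%E).

Let gAB := g \_ (A `*` B).

Let mgAB : measurable_fun setT gAB.
Proof. by apply/(measurable_restrictT g) => //; exact: measurableX. Qed.

Let gAB0 p : (0 <= gAB p)%E.
Proof. exact: erestrict_ge0. Qed.

Let sect1 x : fubini_F m2 gAB x =
  ((fun x => \int[m2]_(y in B) g (x, y))%E \_ A) x.
Proof.
rewrite /fubini_F patchE; case: ifPn => xA.
  rewrite [RHS]integral_mkcond; apply: eq_integral => y _.
  by rewrite /gAB !patchE in_setX xA.
rewrite integral0_eq// => y _.
by rewrite /gAB patchE in_setX (negbTE xA).
Qed.

Let sect2 y : fubini_G m1 gAB y =
  ((fun y => \int[m1]_(x in A) g (x, y))%E \_ B) y.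
Proof.
rewrite /fubini_G patchE; case: ifPn => yB.
  rewrite [RHS]integral_mkcond; apply: eq_integral => x _.
  by rewrite /gAB !patchE in_setX yB andbT.
rewrite integral0_eq// => x _.
by rewrite /gAB patchE in_setX (negbTE yB) andbF.
Qed.

Lemma measurable_rectangle_section1 x : A x ->
  measurable_fun B (fun y => g (x, y)).
Proof.
move=> Ax; apply: (eq_measurable_fun (gAB \o pair x)).
  by move=> y yB; rewrite /gAB /= patchE in_setX yB mem_set.
by apply: measurable_funTS; apply: measurableT_comp.
Qed.

Lemma measurable_rectangle1 :
  measurable_fun A (fun x => \int[m2]_(y in B) g (x, y))%E.
Proof.
apply/(measurable_restrictT _ mA).
have := @measurable_fun_fubini_tonelli_F _ _ _ _ _ m2 gAB mgAB gAB0.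
by rewrite (funext sect1).
Qed.

Lemma measurable_rectangle2 :
  measurable_fun B (fun y => \int[m1]_(x in A) g (x, y))%E.
Proof.
apply/(measurable_restrictT _ mB).
have := @measurable_fun_fubini_tonelli_G _ _ _ _ _ m1 gAB mgAB gAB0.
by rewrite (funext sect2).
Qed.

Lemma fubini_rectangle1 : (\int[m1 \x m2]_(p in A `*` B) g p =
  \int[m1]_(x in A) \int[m2]_(y in B) g (x, y))%E.
Proof.
rewrite integral_mkcond (fubini_tonelli1 _ mgAB gAB0).
by rewrite [RHS]integral_mkcond; apply: eq_integral => x _; exact: sect1.
Qed.

Lemma fubini_rectangle2 : (\int[m1 \x m2]_(p in A `*` B) g p =
  \int[m2]_(y in B) \int[m1]_(x in A) g (x, y))%E.
Proof.
rewrite integral_mkcond (fubini_tonelli2 _ mgAB gAB0).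
by rewrite [RHS]integral_mkcond; apply: eq_integral => x _; exact: sect2.
Qed.

Lemma rectangle_integral_eq0 :
  {ae m1, forall x, A x -> {ae m2, forall y, B y -> g (x, y) = 0%E}} ->
  (\int[m1 \x m2]_(p in A `*` B) g p = 0)%E.
Proof.
move=> ae0; rewrite fubini_rectangle1 (ae_eq_integral (cst 0%E))//.
- by rewrite integral0.
- exact: measurable_rectangle1.
apply: ae_imp ae0 => x + Ax => /(_ Ax) gx0.
rewrite (ae_eq_integral (cst 0%E)) ?integral0//.
exact: measurable_rectangle_section1.
Qed.

End rectangle.

(** Exchanging the factors lets the slice argument, written for the last variable, apply to the
    first one too. *)
Lemma integral_rectangle_swap d1 d2 (T1 : measurableType d1)
    (T2 : measurableType d2) (R : realType)
    (m1 : {sigma_finite_measure set T1 -> \bar R})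
    (m2 : {sigma_finite_measure set T2 -> \bar R})
    (A : set T1) (B : set T2) (g : T1 * T2 -> \bar R) :
  measurable A -> measurable B -> measurable_fun setT g ->
  (forall p, (0 <= g p)%E) ->
  (\int[m2 \x m1]_(p in B `*` A) g (p.2, p.1) =
   \int[m1 \x m2]_(p in A `*` B) g p)%E.
Proof.
move=> mA mB mg g0.
have mgs : measurable_fun setT (fun p : T2 * T1 => g (p.2, p.1)).
  by apply: measurableT_comp mg _; exact: measurable_fun_pair.
rewrite [LHS]fubini_rectangle1//; last exact: measurable_funTS.
by rewrite [RHS]fubini_rectangle2//; exact: measurable_funTS.
Qed.

Section slice_derivative.
Context d (T : measurableType d) (R : realType).
Variables (m : {sigma_finite_measure set T -> \bar R}) (P : set T) (a b c : R).
Hypotheses (mP : measurable P) (ab : a < b).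
Let I : set (measurableTypeR R) := `]a, b[%classic.
Variables (U U' : nat -> T * measurableTypeR R -> R)
  (H : T * measurableTypeR R -> R).
Hypotheses (mU : forall n, measurable_fun setT (U n))
  (mU' : forall n, measurable_fun setT (U' n))
  (dU : forall n y (x : R), is_derive x 1 (fun x : R => U n (y, x)) (U' n (y,
      x)))
  (cU' : forall n y, continuous (fun x : R => U' n (y, x)))
  (iH : (m \x @lebesgue_measure R)%E.-integrable setT (EFin \o H))
  (small : forall e : R, 0 < e -> exists n,
    (\int[m \x @lebesgue_measure R]_(p in P `*` I)
       (`|U n p - c| + `|U' n p - H p|)%:E < e%:E)%E).

(** By Tonelli, on almost every line [U n] comes close to [c] while its derivative comes close to
    [H], so [H] is there a weak derivative of a constant. The index may depend on the line. *)
Lemma slice_derivative_eq0 :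
  (\int[m \x @lebesgue_measure R]_(p in P `*` I) `|H p|%:E = 0)%E.
Proof.
have mI : measurable I by exact: measurable_itv.
have mH : measurable_fun setT H.
  by have /integrableP[/measurable_EFinP] := iH.
pose g n p := (`|U n p - c| + `|U' n p - H p|)%:E.
have mg n : measurable_fun setT (g n).
  apply/measurable_EFinP; apply: measurable_funD.
    by apply: measurableT_comp => //; exact: measurable_funB.
  by apply: measurableT_comp => //; exact: measurable_funB.
have g0 n p : (0 <= g n p)%E.
  by rewrite lee_fin addr_ge0.
apply: rectangle_integral_eq0 => //.
- apply/measurable_EFinP; apply: measurableT_comp => //.
  exact: measurable_funTS.
have iHy := ae_integrable1 iH.
have sm : {ae m, forall y, P y -> forall e : R, 0 < e -> exists n,
    (\int[@lebesgue_measure R]_(x in I)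
      (`|U n (y, x) - c| + `|U' n (y, x) - H (y, x)|)%:E < e%:E)%E}.
  apply: ae_arbitrarily_small_in => //.
  - move=> n; have := @measurable_rectangle1 _ _ _ _ _ (@lebesgue_measure R) P
      I (g n).
    by apply => //; exact: measurable_funTS.
  - by move=> n t; apply: integral_ge0 => x _; exact: g0.
  - move=> e /small[n ne]; exists n; move: ne.
    by rewrite (@fubini_rectangle1 _ _ _ _ _ _ _ P I (g n))//;
      exact: measurable_funTS.
apply: ae_imp (ae_and iHy sm) => y [iy smy] /smy {}smy.
have := ae_eq0_of_small_primitive ab (fun n x => dU n y x)
  (fun n => @cU' n y) iy smy.
by apply: ae_imp => x + xI => -> //; rewrite normr0.
Qed.

End slice_derivative.

(** * Smooth functions restricted to coordinate lines *)

Section lines.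
Context {R : realType} (u : R * R * R -> R).
Hypothesis Cu : Ck 1 u.

Lemma Ck1_continuous : continuous u.
Proof. by case: Cu. Qed.

Lemma Ck1_partial_continuous j : continuous (fun p => 'D_(basis3 j) u p).
Proof. by case: Cu => _ /(_ j)[_ []]. Qed.

(** The directional difference quotient along a basis vector is the one-variable quotient itself, so
    no chain rule intervenes. *)
Lemma is_derive_line0 y z (x : R) :
  is_derive x 1 (fun x : R => u (x, y, z)) ('D_(basis3 0) u (x, y, z)).
Proof.
have E : (fun h => h^-1 *: (u (h *: basis3 0 + (x, y, z)) - u (x, y, z))) =
    (fun h => h^-1 *: (u (h *: (1 : R) + x, y, z) - u (x, y, z))).
  apply/funext => h; congr (_ *: (u _ - _)).
  by rewrite /basis3/=; congr ((_, _), _); rewrite /= -[LHS]/(h * 0 + _) mulr0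
      add0r.
case: Cu => _ /(_ 0)[/(_ (x, y, z)) du _]; move: du.
split; [by move: du; rewrite /derivable E|by rewrite /derive E].
Qed.

Lemma is_derive_line1 x z (y : R) :
  is_derive y 1 (fun y : R => u (x, y, z)) ('D_(basis3 1) u (x, y, z)).
Proof.
have E : (fun h => h^-1 *: (u (h *: basis3 1 + (x, y, z)) - u (x, y, z))) =
    (fun h => h^-1 *: (u (x, h *: (1 : R) + y, z) - u (x, y, z))).
  apply/funext => h; congr (_ *: (u _ - _)).
  by rewrite /basis3/=; congr ((_, _), _); rewrite /= -[LHS]/(h * 0 + _) mulr0
      add0r.
case: Cu => _ /(_ 1)[/(_ (x, y, z)) du _]; move: du.
split; [by move: du; rewrite /derivable E|by rewrite /derive E].
Qed.

Lemma is_derive_line2 q (z : R) :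
  is_derive z 1 (fun z : R => u (q, z)) ('D_(basis3 2) u (q, z)).
Proof.
have E : (fun h => h^-1 *: (u (h *: basis3 2 + (q, z)) - u (q, z))) =
    (fun h => h^-1 *: (u (q, h *: (1 : R) + z) - u (q, z))).
  apply/funext => h; congr (_ *: (u _ - _)); case: q => x y.
  by rewrite /basis3/=; congr ((_, _), _); rewrite /= -[LHS]/(h * 0 + _) mulr0
      add0r.
case: Cu => _ /(_ 2)[/(_ (q, z)) du _]; move: du.
split; [by move: du; rewrite /derivable E|by rewrite /derive E].
Qed.

Lemma continuous_line0 (g : R * R * R -> R) y z : continuous g ->
  continuous (fun x : R => g (x, y, z)).
Proof.
move=> cg x; apply: (@continuous_comp _ _ _ (fun x : R => (x, y, z)) g); last
    exact: cg.
by apply: (cvg_pair (G := nbhs (x, y)) (H := nbhs z)); [apply: (cvg_pair (G :=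
    nbhs x) (H := nbhs y))|];
  (exact: cvg_id || exact: cvg_cst).
Qed.

Lemma continuous_line1 (g : R * R * R -> R) x z : continuous g ->
  continuous (fun y : R => g (x, y, z)).
Proof.
move=> cg y; apply: (@continuous_comp _ _ _ (fun y : R => (x, y, z)) g); last
    exact: cg.
by apply: (cvg_pair (G := nbhs (x, y)) (H := nbhs z)); [apply: (cvg_pair (G :=
    nbhs x) (H := nbhs y))|];
  (exact: cvg_id || exact: cvg_cst).
Qed.

Lemma continuous_line2 (g : R * R * R -> R) q : continuous g ->
  continuous (fun z : R => g (q, z)).
Proof.
move=> cg z; apply: (@continuous_comp _ _ _ (fun z : R => (q, z)) g); last
    exact: cg.
by apply: (cvg_pair (G := nbhs q) (H := nbhs z)); (exact: cvg_id || exact: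
    cvg_cst).
Qed.

End lines.

Lemma ord3_ind (P : 'I_3 -> Prop) : P 0 -> P 1 -> P 2 -> forall i, P i.
Proof.
move=> P0 P1 P2 [[|[|[|//]]] i3].
- by rewrite (_ : Ordinal i3 = 0)//; exact: val_inj.
- by rewrite (_ : Ordinal i3 = 1)//; exact: val_inj.
- by rewrite (_ : Ordinal i3 = 2)//; exact: val_inj.
Qed.

Lemma ord3_neq2 (j : 'I_3) : j != 2 -> j = 0 \/ j = 1.
Proof. by elim/ord3_ind: j; [left|right|]. Qed.

(** Vanishing on almost every horizontal slice is vanishing of the double integral, which Tonelli
    rereads along almost every vertical line. *)
Lemma ae_swap_integral_eq0 d1 d2 (T1 : measurableType d1)
    (T2 : measurableType d2) (R : realType)
    (m1 : {sigma_finite_measure set T1 -> \bar R})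
    (m2 : {sigma_finite_measure set T2 -> \bar R})
    (A : set T1) (B : set T2) (g : T1 * T2 -> R) :
  measurable A -> measurable B -> measurable_fun setT g ->
  {ae m2, forall y, B y -> (\int[m1]_(x in A) `|g (x, y)|%:E = 0)%E} ->
  {ae m1, forall x, A x -> {ae m2, forall y, B y -> g (x, y) = 0}}.
Proof.
move=> mA mB mg ae0.
have mgE : measurable_fun setT (fun p => `|g p|%:E).
  by apply/measurable_EFinP; exact: measurableT_comp.
have mgAB : measurable_fun (A `*` B) (fun p => `|g p|%:E).
  exact: measurable_funTS.
have g0 p : (0 <= `|g p|%:E)%E by rewrite lee_fin.
have : (\int[m1]_(x in A) `|\int[m2]_(y in B) `|g (x, y)|%:E| = 0)%E.
  under eq_integral do rewrite gee0_abs ?integral_ge0//.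
  rewrite -(@fubini_rectangle1 _ _ _ _ _ m1 m2 A B (fun p => `|g p|%:E))//.
  rewrite (@fubini_rectangle2 _ _ _ _ _ m1 m2 A B (fun p => `|g p|%:E))//.
  rewrite (ae_eq_integral (cst 0%E)) ?integral0//.
  exact: (@measurable_rectangle2 _ _ _ _ _ m1 A B (fun p => `|g p|%:E)).
move/(ae_eq_integral_abs _ mA (@measurable_rectangle1 _ _ _ _ _ m2 A B
  (fun p => `|g p|%:E) mA mB mgAB g0)).1.
apply: ae_imp => x + Ax => /(_ Ax) gx0.
have mgx : measurable_fun B (fun y => (g (x, y))%:E).
  apply/measurable_EFinP; apply: measurable_funTS.
  by apply: measurableT_comp => //; exact: pair1_measurable.
have /(ae_eq_integral_abs _ mB mgx).1 : (\int[m2]_(y in B) `|(g (x, y))%:E| =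
    0)%E.
  exact: gx0.
by apply: ae_imp => y + By => /(_ By) [].
Qed.

(** * Horizontal slices and vertical primitive of one component *)

(* F stands for a component of f on the box and G for its gradient; both are
   only known through the smooth functions u n, whose values at height 0
   approach the constant trace p. *)
Section component.
Context {R : realType}.
Notation mR := (measurableTypeR R).
Notation leb := (@lebesgue_measure R).
Let lebs := lebs R.
Let leb2s := leb2s R.
Variables (a b c d : R) (F : mR * mR * mR -> R) (G : 'I_3 -> mR * mR * mR -> R)
  (u : nat -> R * R * R -> R) (p : R).
Hypotheses (ab : a < b) (cd : c < d).
Let I : set mR := `]a, b[%classic.
Let J : set mR := `]c, d[%classic.
Let K : set mR := `]0, 1[%classic.
Let Q : set (mR * mR) := I `*` J.
Hypotheses (mF : measurable_fun setT F)
  (iG : forall j, (leb3 R).-integrable setT (EFin \o G j))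
  (Cu : forall n, Ck 1 (u n)).
Let E n (x : mR * mR * mR) : R := `|u n x - F x| +
  \sum_(j < 3) `|'D_(basis3 j) (u n) x - G j x|.
Hypothesis small : forall e : R, 0 < e -> exists n,
  (\int[leb3 R]_(x in Q `*` K) (E n x)%:E < e%:E)%E /\
  (\int[leb2 R]_(q in Q) `|u n (q, 0 : R) - p|%:E < e%:E)%E.

Let mI : measurable I. Proof. exact: measurable_itv. Qed.
Let mJ : measurable J. Proof. exact: measurable_itv. Qed.
Let mK : measurable K. Proof. exact: measurable_itv. Qed.
Let mQ : measurable Q. Proof. exact: measurableX. Qed.

Let mu n : measurable_fun [set: mR * mR * mR] (u n).
Proof. by apply: continuous3_measurable; exact: Ck1_continuous. Qed.

Let mDu n j : measurable_fun [set: mR * mR * mR] (fun x => 'D_(basis3 j) (u n)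
    x).
Proof. by apply: continuous3_measurable; exact: Ck1_partial_continuous. Qed.

Let mG j : measurable_fun setT (G j).
Proof. by have /integrableP[/measurable_EFinP] := iG j. Qed.

Let mE n : measurable_fun setT (E n).
Proof.
apply: measurable_funD.
  by apply: measurableT_comp => //; exact: measurable_funB.
apply: measurable_sum => j.
by apply: measurableT_comp => //; exact: measurable_funB.
Qed.

Let E0 n x : 0 <= E n x.
Proof. by rewrite addr_ge0// sumr_ge0. Qed.

(** Heights whose slice is itself approximated by the smooth functions, values and gradient
    together; the index may depend on the height. *)
Definition good_height (z : mR) :=
  (forall j, (leb2 R).-integrable setT (fun q => (G j (q, z))%:E)) /\
  forall e : R, 0 < e -> exists n,
    (\int[leb2 R]_(q in Q) (E n (q, z))%:E < e%:E)%E.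

Lemma ae_good_height : {ae leb, forall z, K z -> good_height z}.
Proof.
have h1 : {ae leb, forall z, forall j,
    (leb2 R).-integrable setT (fun q => (G j (q, z))%:E)}.
  have h j : {ae leb, forall z,
      (leb2 R).-integrable setT (fun q => (G j (q, z))%:E)}.
    have H := @ae_integrable2 _ _ _ _ _ leb2s lebs (EFin \o G j) (iG j).
    exact: H.
  apply: ae_imp (ae_and (h 0) (ae_and (h 1) (h 2))) => z [h0 [h1 h2]] j.
  by elim/ord3_ind: j.
have h2 : {ae leb, forall z, K z -> forall e : R, 0 < e -> exists n,
    (\int[leb2 R]_(q in Q) (E n (q, z))%:E < e%:E)%E}.
  apply: ae_arbitrarily_small_in => //.
  - move=> n; apply: (@measurable_rectangle2 _ _ _ _ _ leb2s Q K
      (fun x => (E n x)%:E)) => //.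
    + by apply: measurable_funTS; exact/measurable_EFinP.
    + by move=> x; rewrite lee_fin.
  - by move=> n z; apply: integral_ge0 => q _; rewrite lee_fin.
  - move=> e /small[n [ne _]]; exists n; move: ne.
    rewrite (@fubini_rectangle2 _ _ _ _ _ leb2s lebs Q K (fun x => (E n
        x)%:E))//.
    + by apply: measurable_funTS; exact/measurable_EFinP.
    + by move=> x; rewrite lee_fin.
by apply: ae_imp (ae_and h1 h2) => z [z1 z2] Kz; split => //; exact: z2.
Qed.


(** The combination of the two slices is an L^1 limit of smooth functions whose derivatives converge
    to the same combination of the [G j]; since the limit is constant, that combination is zero. *)
Lemma good_heights_combination_eq0 (z1 z2 : mR) (s t k : R) (j : 'I_3) :
  j != 2 -> good_height z1 -> good_height z2 ->
  {ae leb2s, forall q, Q q -> s * F (q, z1) + t * F (q, z2) = k} ->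
  (\int[leb2 R]_(q in Q) `|s * G j (q, z1) + t * G j (q, z2)|%:E = 0)%E.
Proof.
move=> j2 [iz1 sm1] [iz2 sm2] sFt.
have ser n : 0 < n.+1%:R^-1 :> R by rewrite invr_gt0.
(* The two heights use separate sequences of indices, as only the combined limit matters. *)
have [n1 n1E] := choice (fun n => sm1 _ (ser n)).
have [n2 n2E] := choice (fun n => sm2 _ (ser n)).
pose U n (q : mR * mR) := s * u (n1 n) (q, z1) + t * u (n2 n) (q, z2).
pose U' n (q : mR * mR) := s * 'D_(basis3 j) (u (n1 n)) (q, z1) +
   t * 'D_(basis3 j) (u (n2 n)) (q, z2).
pose H (q : mR * mR) := s * G j (q, z1) + t * G j (q, z2).
have msec (g : mR * mR * mR -> R) z : measurable_fun setT g ->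
    measurable_fun setT (fun q : mR * mR => g (q, z)).
  by move=> mg; apply: measurableT_comp => //; exact: pair2_measurable.
have mU n : measurable_fun setT (U n).
  by apply: measurable_funD; apply: measurable_funM => //; exact: (msec (u _)).
have mU' n : measurable_fun setT (U' n).
  by apply: measurable_funD; apply: measurable_funM => //;
    exact: (msec (fun x => 'D_(basis3 j) (u _) x)).
have iH : (leb2 R).-integrable setT (EFin \o H).
  have i1 := integrableZl measurableT s (iz1 j).
  have i2 := integrableZl measurableT t (iz2 j).
  by apply: eq_integrable (integrableD measurableT i1 i2).
have mH : measurable_fun setT H.
  by have /integrableP[/measurable_EFinP] := iH.
have smallU : forall e : R, 0 < e -> exists n,
  (\int[leb2 R]_(q in Q) (`|U n q - k| + `|U' n q - H q|)%:E < e%:E)%E.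
  (* Each slice error is below 1/(n+1), so the weighted sum is at most M/(n+1), which this [n] puts
     below [e]. *)
  move=> e e0; pose M : R := `|s| + `|t|; pose n := Num.truncn (M / e).
  have M0 : 0 <= M by rewrite addr_ge0.
  have ne : M * n.+1%:R^-1 < e.
    by rewrite ltr_pdivrMr// mulrC -ltr_pdivrMr// truncnS_gt.
  exists n.
  have mEz i z : measurable_fun Q (fun q => (E i (q, z))%:E).
    by apply/measurable_EFinP; apply: measurable_funTS; apply: msec; exact: mE.
  apply: (@le_lt_trans _ _ (\int[leb2 R]_(q in Q)
      (`|s|%:E * (E (n1 n) (q, z1))%:E + `|t|%:E * (E (n2 n) (q, z2))%:E))%E).
    apply: (@ae_ge0_le_integral _ _ _ leb2s) => //.
    - apply/measurable_EFinP; apply: measurable_funTS; apply: measurable_funD.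
        by apply: measurableT_comp => //; exact: measurable_funB.
      by apply: measurableT_comp => //; exact: measurable_funB.
    - by move=> q _; rewrite -!EFinM -EFinD lee_fin addr_ge0// mulr_ge0.
    - by apply: emeasurable_funD; exact: measurable_funeM.
    apply: ae_imp sFt => q sFq /sFq <-.
    rewrite -!EFinM -EFinD lee_fin /U /U' /H.
    have Ej i x : `|u i x - F x| + `|'D_(basis3 j) (u i) x - G j x| <= E i x.
      by rewrite lerD2l (bigD1 j)//= lerDl sumr_ge0.
    have := ler_wpM2l (normr_ge0 s) (Ej (n1 n) (q, z1)).
    have := ler_wpM2l (normr_ge0 t) (Ej (n2 n) (q, z2)).
    rewrite !mulrDr -!normrM !mulrBr.
    have tri (x1 x2 y1 y2 : R) : `|x1 + x2 - (y1 + y2)| <= `|x1 - y1| + `|x2 -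
        y2|.
      by rewrite opprD addrACA ler_normD.
    have := tri (s * u (n1 n) (q, z1)) (t * u (n2 n) (q, z2))
      (s * F (q, z1)) (t * F (q, z2)).
    have := tri (s * 'D_(basis3 j) (u (n1 n)) (q, z1))
      (t * 'D_(basis3 j) (u (n2 n)) (q, z2)) (s * G j (q, z1)) (t * G j (q,
          z2)).
    lra.
  have ge0 (x : R) i z q : (0 <= `|x|%:E * (E i (q, z))%:E)%E.
    by rewrite -EFinM lee_fin mulr_ge0.
  rewrite (@ge0_integralD _ _ _ leb2s)//; [|exact: measurable_funeM|exact:
      measurable_funeM].
  have E0e i z q : (0 <= (E i (q, z))%:E)%E by rewrite lee_fin.
  rewrite (@ge0_integralZl_EFin _ _ _ leb2s _ mQ _ (fun q _ => E0e _ z1 q) (mEz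
      _ _) _ (normr_ge0 s)).
  rewrite (@ge0_integralZl_EFin _ _ _ leb2s _ mQ _ (fun q _ => E0e _ z2 q) (mEz
      _ _) _ (normr_ge0 t)).
  apply: le_lt_trans (_ : _ <= (M * n.+1%:R^-1)%:E)%E _; last by rewrite
      lte_fin.
  rewrite mulrDl EFinD !EFinM.
  by apply: leeD; apply: lee_wpmul2l; rewrite ?lee_fin// ltW.
case: (ord3_neq2 j2) => j01; subst j.
(* For the first horizontal variable the coordinates are exchanged, so that the variable of
   differentiation comes last. *)
- pose Us n (p : mR * mR) := U n (p.2, p.1).
  pose Us' n (p : mR * mR) := U' n (p.2, p.1).
  pose Hs (p : mR * mR) := H (p.2, p.1).
  have msw (g : mR * mR -> R) : measurable_fun setT g ->
      measurable_fun setT (fun p : mR * mR => g (p.2, p.1)).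
    by move=> mg; apply: measurableT_comp => //; exact: measurable_fun_pair.
  have iHs : (leb2 R).-integrable setT (EFin \o Hs).
    apply/integrableP; split; first by apply/measurable_EFinP; exact: msw.
    have /integrableP[_] := iH.
    rewrite -!setXTT -(@integral_rectangle_swap _ _ _ _ _ lebs lebs)//.
    by apply/measurable_EFinP; apply: measurableT_comp.
  transitivity (\int[leb2 R]_(p in J `*` I) `|Hs p|%:E)%E.
    apply/esym; apply: (@integral_rectangle_swap _ _ _ _ _ lebs lebs I J
      (fun q => `|H q|%:E)) => //.
    by apply/measurable_EFinP; apply: measurableT_comp.
  apply: (@slice_derivative_eq0 _ _ _ lebs J a b k mJ ab Us Us' Hs) => //.
  - by move=> n; exact: msw.
  - by move=> n; exact: msw.
  - by move=> n y x; apply: is_deriveD; apply: is_deriveZ; exact: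
      is_derive_line0.
  - move=> n y x; have c1 i z : continuous (fun x : R => 'D_(basis3 0) (u i)
      (x, y, z)).
      exact: (@continuous_line0 R _ y z (@Ck1_partial_continuous R (u i) (Cu i)
          0)).
    by apply: cvgD; (apply: cvgM; [exact: cvg_cst|exact: c1]).
  - move=> e /smallU[n ne]; exists n; apply: le_lt_trans ne; rewrite le_eqVlt;
      apply/orP; left; apply/eqP.
    apply: (@integral_rectangle_swap _ _ _ _ _ lebs lebs I J
      (fun q => (`|U n q - k| + `|U' n q - H q|)%:E)) => //.
    apply/measurable_EFinP; apply: measurable_funD;
     by apply: measurableT_comp => //; exact: measurable_funB.
apply: (@slice_derivative_eq0 _ _ _ lebs I c d k mI cd U U' H) => //.
- by move=> n y x; apply: is_deriveD; apply: is_deriveZ; exact: is_derive_line1.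
- move=> n y x; have c1 i z : continuous (fun x : R => 'D_(basis3 1) (u i) (y,
    x, z)).
      exact: (@continuous_line1 R _ y z (@Ck1_partial_continuous R (u i) (Cu i)
          1)).
    by apply: cvgD; (apply: cvgM; [exact: cvg_cst|exact: c1]).
Qed.

Lemma slices_eq0 (j : 'I_3) (k : mR -> R) : j != 2 ->
  {ae leb, forall z, K z -> {ae leb2s, forall q, Q q -> F (q, z) = k z}} ->
  {ae leb2s, forall q, Q q -> {ae leb, forall z, K z -> G j (q, z) = 0}}.
Proof.
move=> j2 Fk; apply: ae_swap_integral_eq0 => //.
apply: ae_imp (ae_and ae_good_height Fk) => z [gz Fkz] Kz.
(* Weights 1 and 0 at the same height reduce the combination to a single slice. *)
have := @good_heights_combination_eq0 z z 1 0 (k z) j j2 (gz Kz) (gz Kz).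
have Fk1 : {ae leb2s, forall q, Q q -> 1 * F (q, z) + 0 * F (q, z) = k z}.
  by apply: ae_imp (Fkz Kz) => q; rewrite mul1r mul0r addr0.
move=> /(_ Fk1) <-; apply: eq_integral => q _.
by rewrite mul1r mul0r addr0.
Qed.

(** Comparison with one fixed height [z0] where [w] is nonzero: w(z0) F(., z) - w(z) F(., z0)
    vanishes, hence so do its horizontal derivatives. *)
Lemma slices_proportional (w : mR -> R) (V : mR * mR -> R) (j : 'I_3) :
  j != 2 -> measurable_fun setT w ->
  (forall q z, Q q -> K z -> F (q, z) = w z * V q) ->
  exists A : mR * mR -> R, {ae leb2s, forall q, Q q ->
    {ae leb, forall z, K z -> G j (q, z) = w z * A q}}.
Proof.
move=> j2 mw FwV.
have [[z0 [Kz0 gz0 wz0]]|now0] :=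
  pselect (exists z0, [/\ K z0, good_height z0 & w z0 != 0]); last first.
  (* Without a usable [z0], [w] vanishes at almost every height, and then so do [F] and its
     horizontal derivatives. *)
  exists (cst 0).
  have w0 : {ae leb, forall z, K z -> w z = 0}.
    apply: ae_imp ae_good_height => z gz Kz; apply/eqP/negP => /negP wz.
    by apply: now0; exists z; split => //; exact: gz.
  have := @slices_eq0 j (cst 0) j2.
  have F0 : {ae leb, forall z, K z -> {ae leb2s, forall q, Q q -> F (q, z) =
      0}}.
    apply: ae_imp w0 => z wz Kz; apply: aeW => q Qq.
    by rewrite FwV// wz// mul0r.
  move=> /(_ F0); apply: ae_imp => q + Qq => /(_ Qq); apply: ae_imp => z Gz Kz.
  by rewrite mulr0 Gz.
exists (fun q => G j (q, z0) / w z0).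
have prop0 : {ae leb2s, forall q, Q q ->
    {ae leb, forall z, K z -> w z0 * G j (q, z) + - w z * G j (q, z0) = 0}}.
  apply: (@ae_swap_integral_eq0 _ _ _ _ _ leb2s lebs Q K
    (fun x => w z0 * G j (x.1, x.2) + - w x.2 * G j (x.1, z0))) => //.
    apply: measurable_funD; apply: measurable_funM => //.
    - by apply: measurableT_comp => //; exact: measurable_fun_pair.
    - by apply: measurableT_comp => //; exact: measurableT_comp.
    - by apply: measurableT_comp => //; exact: measurable_fun_pair.
  apply: ae_imp ae_good_height => z gz Kz.
  apply: (@good_heights_combination_eq0 z z0 (w z0) (- w z) 0 j j2 (gz Kz) gz0).
  by apply: aeW => q Qq; rewrite !FwV//; ring.
apply: ae_imp prop0 => q + Qq => /(_ Qq); apply: ae_imp => z + Kz => /(_ Kz) h.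
by apply: (mulfI wz0); rewrite [RHS]mulrCA [w z0 * (_ / _)]mulrC divfK//; lra.
Qed.

(** The increment formula for [u n] from height 0 passes to the limit: the error at height 0 is the
    trace error, the error at [z] is pointwise, and the error under the integral is an L^1 norm on
    the line. *)
Lemma vertical_primitive : {ae leb2s, forall q, Q q ->
  leb.-integrable setT (fun z => (G 2 (q, z))%:E) /\
  {ae leb, forall z, K z ->
    F (q, z) = p + \int[leb]_(s in `]0, z]) G 2 (q, s)}}.
Proof.
have K1 : leb K = 1%:E by rewrite lebesgue_measure_itv/= lte_fin ltr01 sube0.
have mEK n : measurable_fun (Q `*` K) (fun x => (E n x)%:E).
  by apply/measurable_EFinP; exact: measurable_funTS.
have mEq n q : measurable_fun K (fun z => (E n (q, z))%:E).
  apply/measurable_EFinP; apply: measurable_funTS.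
  by apply: measurableT_comp => //; exact: pair1_measurable.
have E0e n x : (0 <= (E n x)%:E)%E by rewrite lee_fin.
(* These are the errors that do not depend on z; for fixed [q] they form the constant term when
   almost every [z] is treated. *)
pose k n (q : mR * mR) : \bar R := (`|u n (q, 0 : R) - p|%:E +
  \int[leb]_(z in K) (E n (q, z))%:E)%E.
have IE0 n q : (0 <= \int[leb]_(z in K) (E n (q, z))%:E)%E.
  by apply: integral_ge0 => z _.
have k0 n q : (0 <= k n q)%E by rewrite adde_ge0// lee_fin.
have mu0 n : measurable_fun Q (fun q => `|u n (q, 0 : R) - p|%:E).
  apply/measurable_EFinP; apply: measurable_funTS.
  apply: measurableT_comp => //; apply: measurable_funB => //.
  by apply: measurableT_comp (mu n) _; exact: pair2_measurable.
have mIE n : measurable_fun Q (fun q => \int[leb]_(z in K) (E n (q, z))%:E)%E.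
  exact: (@measurable_rectangle1 _ _ _ _ _ lebs Q K (fun x => (E n x)%:E)).
have ksmall : {ae leb2s, forall q, Q q ->
    forall e : R, 0 < e -> exists n, (k n q < e%:E)%E}.
  apply: ae_arbitrarily_small_in => //.
    by move=> n; exact: emeasurable_funD.
  move=> e e0; have /small[n [En un]] : 0 < e / 2 by rewrite divr_gt0.
  exists n; rewrite (@ge0_integralD _ _ _ leb2s)//.
  rewrite (splitr e) EFinD lteD//.
  by rewrite (@fubini_rectangle1 _ _ _ _ _ leb2s lebs Q K (fun x => (E n
      x)%:E)) in En.
have iGq := @ae_integrable1 _ _ _ _ _ leb2s lebs (EFin \o G 2) (iG 2).
apply: ae_imp (ae_and iGq ksmall) => q [iq kq] Qq; split => //.
have {}kq : {ae leb, forall z, K z ->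
    forall e : R, 0 < e -> exists n, (k n q + (E n (q, z))%:E < e%:E)%E}.
  apply: (@ae_arbitrarily_small_cst _ _ _ lebs K (k ^~ q)
    (fun n z => (E n (q, z))%:E) 1) => // e e0.
  have /(kq Qq)[n ne] : 0 < e / 2 by rewrite divr_gt0.
  exists n; rewrite (splitr e) EFinD lteD//.
  by apply: le_lt_trans ne; rewrite leeDr// lee_fin.
apply: ae_imp kq => z + Kz => /(_ Kz) kz.
apply/eqP; rewrite -subr_eq0 -normr_le0; apply/ler_addgt0Pr => e /kz[n ne].
rewrite add0r -lee_fin; apply: ltW; apply: le_lt_trans ne.
move: (Kz); rewrite /K/= in_itv/= => /andP[z0 z1].
have zK : `]0, z] `<=` K.
  move=> s; rewrite /K/= !in_itv/= => /andP[s0 sz].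
  by rewrite s0/= (le_lt_trans sz).
have iK : leb.-integrable K (EFin \o (fun z => G 2 (q, z))).
  exact: integrableS iq.
have := C1_increment_error z0 mK zK (fun z => is_derive_line2 (Cu n) q z)
  (@continuous_line2 R _ q (@Ck1_partial_continuous R (u n) (Cu n) 2)) iK.
have IE2 : (\int[leb]_(x in K) `|'D_(basis3 2) (u n) (q, x) - G 2 (q, x)|%:E <=
    \int[leb]_(x in K) (E n (q, x))%:E)%E.
  apply: ge0_le_integral => //.
    apply/measurable_EFinP; apply: measurable_funTS.
    apply: measurableT_comp => //; apply: measurable_funB.
      by apply: measurableT_comp (mDu n 2) _; exact: pair1_measurable.
    by apply: measurableT_comp => //; exact: pair1_measurable.
  by move=> x _; rewrite lee_fin /E (bigD1 2)//= addrCA lerDl addr_ge0//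
      sumr_ge0.
move=> /le_trans/(_ IE2); rewrite /k; move: (IE0 n q).
move: (integral _ _ _) => i i0 h.
have : (`|F (q, z) - (p + \int[leb]_(s in `]0, z]) G 2 (q, s))|%:E <=
  `|u n (q, 0 : R) - p|%:E + `|u n (q, z) - u n (q, 0 : R) -
    \int[leb]_(s in `]0, z]) G 2 (q, s)|%:E + (E n (q, z))%:E)%E.
  move: (Rintegral _ _ _) => c0.
  rewrite -!EFinD lee_fin.
  have : `|u n (q, z) - F (q, z)| <= E n (q, z) by rewrite lerDl sumr_ge0.
  have := ler_normD (u n (q, 0 : R) - p) (u n (q, z) - u n (q, 0 : R) - c0).
  have := ler_normB (u n (q, 0 : R) - p + (u n (q, z) - u n (q, 0 : R) - c0))
    (u n (q, z) - F (q, z)).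
  rewrite (_ : _ - _ = F (q, z) - (p + c0)); last by ring.
  lra.
by move=> /le_trans; apply; rewrite leeD2r// leeD2l.
Qed.

End component.

(** * The divergence at height 0, the determinant bound and the limit at the trace *)

(* Since S is nondecreasing, s <= r S on ]0, e] gives S e <= S e * int r. *)
Lemma no_integrable_log_derivative (R : realType)
    (s r : measurableTypeR R -> R) (S := fun z : R =>
      \int[lebesgue_measure]_(t in `]0, z]) s t) :
  (forall z, 0 <= s z) -> (forall z, 0 <= r z) ->
  lebesgue_measure.-integrable `]0, 1[ (EFin \o s) ->
  lebesgue_measure.-integrable `]0, 1[ (EFin \o r) ->
  (forall z, z \in `]0, 1[ -> 0 < S z) ->
  {ae @lebesgue_measure R, forall z, z \in `]0, 1[ -> s z <= r z * S z} ->
  False.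
Proof.
move=> s0 r0 is_ ir S0 sr.
pose K : set (measurableTypeR R) := `]0, 1[%classic.
have mK : measurable K by exact: measurable_itv.
have irK : lebesgue_measure.-integrable setT (EFin \o (r \_ K)).
  by rewrite -restrict_EFin -integrable_mkcond.
(* Absolute continuity of the integral: [r] has integral below 1 over any set of measure below [d],
   in particular over ]0, e]. *)
have [d [d0 rd]] := integral_normr_continuous irK ltr01.
pose e := Num.min (d / 2) (1 / 2).
have e0 : 0 < e by rewrite lt_min !divr_gt0.
have e1 : e < 1 by rewrite gt_min; apply/orP; right; lra.
have ed : e < d by rewrite gt_min; apply/orP; left; lra.
pose A : set (measurableTypeR R) := `]0, e]%classic.
have mA : measurable A by exact: measurable_itv.
have AK : A `<=` K.
  by move=> z; rewrite /A /K/= !in_itv/= => /andP[-> /le_lt_trans ->].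
have Ae : (@lebesgue_measure R A < d%:E)%E.
  by rewrite lebesgue_measure_itv/= lte_fin e0 sube0 lte_fin.
have isA : lebesgue_measure.-integrable A (EFin \o s) by exact: integrableS is_.
have irA : lebesgue_measure.-integrable A (EFin \o r) by exact: integrableS ir.
have rA : \int[lebesgue_measure]_(z in A) r z < 1.
  apply: le_lt_trans (rd A mA Ae); rewrite le_eqVlt; apply/orP; left; apply/eqP.
  apply: eq_Rintegral => z zA; rewrite patchE mem_set ?ger0_norm//.
  by apply: AK; exact: set_mem.
have Se : S e = fine (\int[lebesgue_measure]_(z in A) (s z)%:E) by [].
have le1 : (\int[lebesgue_measure]_(z in A) (s z)%:E <=
    \int[lebesgue_measure]_(z in A) ((S e)%:E * (r z)%:E))%E.
  apply: ae_ge0_le_integral => //.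
  - by move=> z _; rewrite lee_fin.
  - by have /integrableP[] := isA.
  - move=> z _; rewrite -EFinM lee_fin mulr_ge0// ltW// S0//.
    by rewrite in_itv/= e0.
  - by apply: measurable_funeM; have /integrableP[] := irA.
  apply: ae_imp sr => z sz zA; have zK := AK z zA.
  rewrite -EFinM lee_fin (le_trans (sz zK))// mulrC ler_wpM2r//.
  move: zA; rewrite /A/= in_itv/= => /andP[z0 ze].
  rewrite -lee_fin /S /Rintegral !fineK; last 2 first.
  - exact: integrable_fin_num.
  - apply: integrable_fin_num => //; apply: integrableS isA => //.
    by apply: subset_itvl; rewrite bnd_simp.
  apply: ge0_subset_integral => //.
  - by have /integrableP[] := isA.
  - by move=> x _; rewrite lee_fin.
  - by apply: subset_itvl; rewrite bnd_simp.
move: le1; rewrite integralZl// -(fineK (integrable_fin_num mA irA)).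
rewrite -[X in (X <= _)%E](fineK (integrable_fin_num mA isA)) -EFinM lee_fin.
rewrite -/(Rintegral _ _ _) -/(Rintegral _ _ _) leNgt => /negP; apply.
by rewrite -/(S e) -[X in _ < X]mulr1 ltr_pM2l// S0// in_itv/= e0.
Qed.

Lemma det2E (R : comNzRingType) (A : 'M[R]_2) :
  \det A = A 0 0 * A 1 1 - A 0 1 * A 1 0.
Proof.
(* Indexing by naturals identifies the different ordinal terms that the row expansion creates for
   one and the same index. *)
pose e (i j : nat) := A (inord i) (inord j).
have Ae i j : A i j = e i j by rewrite /e !inord_val.
rewrite (expand_det_row A ord0) !big_ord_recl big_ord0 /cofactor !det_mx11.
by rewrite !mxE !Ae /= /bump /=; ring.
Qed.

Lemma det3E (R : comNzRingType) (A : 'M[R]_3) :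
  \det A = A 0 0 * (A 1 1 * A 2 2 - A 1 2 * A 2 1)
         - A 0 1 * (A 1 0 * A 2 2 - A 1 2 * A 2 0)
         + A 0 2 * (A 1 0 * A 2 1 - A 1 1 * A 2 0).
Proof.
pose e (i j : nat) := A (inord i) (inord j).
have Ae i j : A i j = e i j by rewrite /e !inord_val.
rewrite (expand_det_row A ord0) !big_ord_recl big_ord0 /cofactor !det2E.
by rewrite !mxE !Ae /= /bump /=; ring.
Qed.

Lemma sum3E (V : zmodType) (f : 'I_3 -> V) : \sum_(i < 3) f i = f 0 + f 1 + f 2.
Proof.
rewrite !big_ord_recl big_ord0 addr0 addrA.
by congr (f _ + f _ + f _); exact: val_inj.
Qed.

(** Each of the six Leibniz products takes one entry from every column, so it is among the 27
    products obtained by expanding the right-hand side. *)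
Lemma det3_le (R : realDomainType) (A : 'M[R]_3) :
  \det A <= (\sum_(i < 3) `|A i 0|) * (\sum_(i < 3) `|A i 1|) *
            (\sum_(i < 3) `|A i 2|).
Proof.
rewrite det3E !sum3E.
have le (x y z : R) : x * y * z <= `|x| * `|y| * `|z| /\
    - (x * y * z) <= `|x| * `|y| * `|z|.
  by rewrite -!normrM; split; [exact: ler_norm|rewrite ler_normr lexx orbT].
have ge0 (x y z : R) : 0 <= `|x| * `|y| * `|z| by rewrite !mulr_ge0.
have [+ _] := le (A 0 0) (A 1 1) (A 2 2); have [_ +] := le (A 0 0) (A 2 1) (A 1
    2).
have [_ +] := le (A 1 0) (A 0 1) (A 2 2); have [+ _] := le (A 2 0) (A 0 1) (A 1
    2).
have [+ _] := le (A 1 0) (A 2 1) (A 0 2); have [_ +] := le (A 2 0) (A 1 1) (A 0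
    2).
(* The next three lines list the 21 index triples with a repetition; the other six are the
   permutations. *)
have g := fun i j k => ge0 (A i 0) (A j 1) (A k 2).
have := (g 0 0 0, g 0 0 1, g 0 0 2, (g 0 1 0, g 0 1 1), (g 0 2 0, g 0 2 2)).
have := (g 1 0 0, g 1 0 1, (g 1 1 0, g 1 1 1, g 1 1 2), (g 1 2 1, g 1 2 2)).
have := ((g 2 0 0, g 2 0 2), (g 2 1 1, g 2 1 2), (g 2 2 0, g 2 2 1, g 2 2 2)).
move: (A 0 0) (A 0 1) (A 0 2) (A 1 0) (A 1 1) (A 1 2) (A 2 0) (A 2 1) (A 2 2).
move=> a b c d e f h i j.
move=> [[[? ?] [? ?]] [[? ?] ?]] [[[? ?] [[? ?] ?]] [? ?]] [[[[? ?] ?] [? ?]]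
    [? ?]].
move=> *; lra.
Qed.

(** The identity holds only for almost every z, so the limit is tested by contradiction: distinct
    limits would make it fail on a whole interval ]0, d[, which has positive measure. *)
Lemma vertical_limit (R : realType) (w g : R -> R) (v p l : R) :
  lebesgue_measure.-integrable setT (EFin \o g) ->
  w z @[z --> 0^'+] --> l ->
  {ae @lebesgue_measure R, forall z, z \in `]0, 1[ ->
    w z * v = p + \int[lebesgue_measure]_(s in `]0, z]) g s} ->
  v * l = p.
Proof.
move=> ig wl wv; apply/eqP/negP => /negP nz.
pose S z := \int[lebesgue_measure]_(s in `]0, z]) g s.
have S0 : S z @[z --> (0 : R)^'+] --> (0 : R).
  apply: cvg_at_right_filter.
  have i01 : lebesgue_measure.-integrable `[0, 1] (EFin \o g).
    by apply: integrableS ig.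
  have := parameterized_integral_cvg_left ltr01 i01.
  apply: cvg_trans; apply: near_eq_cvg; near=> z.
  rewrite /S /parameterized_integral Rintegral_itv_obnd_cbnd//.
  exact: integrableS ig.
have lim : w z * v - (p + S z) @[z --> (0 : R)^'+] --> l * v - (p + 0).
  by apply: cvgB; [apply: cvgM => //; exact: cvg_cst|
    apply: cvgD => //; exact: cvg_cst].
have nz' : l * v - (p + 0) != 0 by rewrite addr0 subr_eq0 mulrC.
have : nbhs (0 : R)^'+ [set z | w z * v - (p + S z) != 0].
  exact: (cvgr_neq0 _ lim nz').
move=> /nbhs_ballP[e /= e0 ne].
pose d := Num.min e 1; have d0 : 0 < d by rewrite lt_min e0 ltr01.
have [z] : exists2 z, z \in `]0, d[ &
    z \in `]0, 1[ -> w z * v = p + \int[lebesgue_measure]_(s in `]0, z]) g s.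
  by apply: ae_ex_itv => //; apply: ae_imp wv.
rewrite !in_itv/= lt_min => /and3P[z0 ze z1] wz.
have := ne z; rewrite /ball/= sub0r normrN gtr0_norm// => /(_ ze z0).
by rewrite wz ?z0// subrr eqxx.
Unshelve. all: by end_near. Qed.

(** * The contradiction on one box *)

Section box.
Context {R : realType}.
Notation mR := (measurableTypeR R).
Notation leb := (@lebesgue_measure R).
Variables (a b c d : R).
Let I : set mR := `]a, b[%classic.
Let J : set mR := `]c, d[%classic.
Let K : set mR := `]0, 1[%classic.
Let Q : set (mR * mR) := I `*` J.
Variables (F : 'I_3 -> mR * mR * mR -> R)
  (G : 'I_3 -> 'I_3 -> mR * mR * mR -> R)
  (u : 'I_3 -> nat -> R * R * R -> R) (p : 'I_3 -> R)
  (W : 'I_3 -> mR -> R) (V : 'I_3 -> mR * mR -> R) (l : 'I_3 -> R)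
  (rho : mR * mR * mR -> R).
Hypotheses (ab : a < b) (cd : c < d)
  (mF : forall i, measurable_fun setT (F i))
  (iG : forall i j, (leb3 R).-integrable setT (EFin \o G i j))
  (Cu : forall i n, Ck 1 (u i n))
  (small : forall i (e : R), 0 < e -> exists n,
    (\int[leb3 R]_(x in Q `*` K) (`|u i n x - F i x| +
       \sum_(j < 3) `|'D_(basis3 j) (u i n) x - G i j x|)%:E < e%:E)%E /\
    (\int[leb2 R]_(q in Q) `|u i n (q, 0 : R) - p i|%:E < e%:E)%E)
  (mW : forall i, measurable_fun setT (W i))
  (lW : forall i, W i z @[z --> (0 : R)^'+] --> l i)
  (FWV : forall i q z, Q q -> K z -> F i (q, z) = W i z * V i q)
  (W01 : W 0 = W 1) (l01 : l 0 = l 1)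
  (V2 : (forall q, Q q -> V 2 q != 0) \/ (forall z, W 2 z = 0))
  (rho0 : forall x, 0 <= rho x)
  (irho : (leb3 R).-integrable setT (EFin \o rho))
  (det_rho : {ae leb3 R, forall x, (Q `*` K) x ->
     0 < \det (\matrix_(i, j) G i j x) /\
     (\sum_(i < 3) `|G i 2 x|) ^+ 3 <= rho x * \det (\matrix_(i, j) G i j x)}).

Let vert i := @vertical_primitive R a b c d (F i) (G i) (u i) (p i)
  (mF i) (iG i) (Cu i) (@small i).

Let aeQ (P : mR * mR -> Prop) : {ae leb2s R, forall q, Q q -> P q} ->
  exists2 q, Q q & P q.
Proof.
have mQ : measurable Q by apply: measurableX; exact: measurable_itv.
have Q0 : (leb2s R Q != 0)%E.
  rewrite (_ : leb2s R Q = ((b - a) * (d - c))%:E).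
    by rewrite eqe mulf_neq0// subr_eq0 gt_eqF.
  have -> : leb2s R Q = (leb I * leb J)%E.
    by apply: product_measure1E; exact: measurable_itv.
  by rewrite !lebesgue_measure_itv/= !lte_fin ab cd -!EFinD -EFinM.
exact: (ae_ex mQ Q0).
Qed.

Let aeK (P : mR -> Prop) : {ae leb, forall z, K z -> P z} -> exists2 z, K z & P
    z.
Proof. exact: (@ae_ex_itv R 0 1 P ltr01). Qed.

Let ae_det : {ae leb2s R, forall q, Q q -> {ae leb, forall z, K z ->
     0 < \det (\matrix_(i, j) G i j (q, z)) /\
     (\sum_(i < 3) `|G i 2 (q, z)|) ^+ 3 <=
       rho (q, z) * \det (\matrix_(i, j) G i j (q, z))}}.
Proof.
have := @ae_xsection _ _ _ _ _ (leb2s R) (lebs R) _ det_rho.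
by apply: ae_imp => q + Qq; apply: ae_imp => z + Kz; apply.
Qed.

Let trace_eq i : {ae leb2s R, forall q, Q q -> V i q * l i = p i}.
Proof.
apply: ae_imp (vert i) => q + Qq => /(_ Qq)[iq aez].
apply: (@vertical_limit R (W i) (fun z => G i 2 (q, z)) (V i q) (p i) (l i)
  iq (@lW i)); apply: ae_imp aez => z + Kz => /(_ Kz).
by rewrite FWV.
Qed.

(** A nonzero limit of [W i] determines [V i q] as p_i / l_i, so the component depends on z only. *)
Let constant_eq0 i j : l i != 0 -> j != 2 ->
  {ae leb2s R, forall q, Q q -> {ae leb, forall z, K z -> G i j (q, z) = 0}}.
Proof.
move=> li j2.
apply: (@slices_eq0 R a b c d (F i) (G i) (u i) (p i) ab cd
  (mF i) (iG i) (Cu i) (@small i) j (fun z => W i z * (p i / l i)) j2).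
apply: aeW => z Kz; apply: ae_imp (trace_eq i) => q + Qq => /(_ Qq) <-.
by rewrite mulfK// FWV.
Qed.

(** The gradients of the first two components would both be vertical, hence parallel, and the
    determinant would vanish. *)
Let zero_rows_contradiction :
  (forall i j, i != 2 -> j != 2 ->
    {ae leb2s R, forall q, Q q -> {ae leb, forall z, K z -> G i j (q, z) = 0}})
        ->
  False.
Proof.
move=> G0; have o2 : (0 : 'I_3) != 2 by []. have o12 : (1 : 'I_3) != 2 by [].
have [q Qq [dq [q00 [q01 [q10 q11]]]]] := aeQ (ae_andD ae_det
  (ae_andD (G0 0 0 o2 o2) (ae_andD (G0 0 1 o2 o12)
  (ae_andD (G0 1 0 o12 o2) (G0 1 1 o12 o12))))).
have [z Kz [dz [z00 [z01 [z10 z11]]]]] := aeK (ae_andD dq (ae_andD q00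
  (ae_andD q01 (ae_andD q10 q11)))).
move: dz.1; rewrite det3E !mxE z00 z01 z10 z11 !(mul0r, mulr0, subrr, subr0,
    addr0).
by rewrite ltxx.
Qed.

Lemma profiles_not_zero : ~ (forall q, Q q -> V 0 q = 0 /\ V 1 q = 0).
Proof.
move=> V0; apply: zero_rows_contradiction => i j i2 j2.
apply: (@slices_eq0 R a b c d (F i) (G i) (u i) (p i) ab cd
  (mF i) (iG i) (Cu i) (@small i) j (cst 0) j2).
apply: aeW => z Kz; apply: aeW => q Qq; rewrite FWV//.
by have [->|->] := ord3_neq2 i2; rewrite ?(V0 q Qq).1 ?(V0 q Qq).2 mulr0.
Qed.

Let l0 : l 0 = 0.
Proof.
apply/eqP/negP => /negP l0; apply: zero_rows_contradiction => i j i2 j2.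
by apply: constant_eq0 => //; have [->|->] := ord3_neq2 i2; rewrite -?l01.
Qed.

Let p_eq0 i : l i = 0 -> p i = 0.
Proof.
by move=> li; have [q _ <-] := aeQ (trace_eq i); rewrite li mulr0.
Qed.

Let s (q : mR * mR) (z : mR) := \sum_(i < 3) `|G i 2 (q, z)|.
Let S (q : mR * mR) (z : R) := \int[leb]_(t in `]0, z]) s q t.

Let s0 q z : 0 <= s q z.
Proof. by rewrite sumr_ge0. Qed.

Let S0 q z : 0 <= S q z.
Proof. by apply: Rintegral_ge0 => t _; exact: s0. Qed.

Let integrable_s q : (forall i, leb.-integrable setT (fun z => (G i 2 (q,
    z))%:E)) ->
  leb.-integrable setT (EFin \o s q).
Proof.
move=> iq.
have := @integrable_sum _ _ _ leb setT measurableT _ (index_enum 'I_3) xpredT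
  (fun i z => `|(G i 2 (q, z))%:E|%E) (fun i _ => integrable_abse (iq i)).
by apply: eq_integrable => // z _; rewrite /= /s -sumEFin.
Qed.

(** As p_k = 0, |W(z) V_k(q)| is the modulus of a vertical integral and at most S; division by
    |V_k(q)| bounds W. Row [k] may differ from row [i]: either of the first two components can
    supply the bound for both. *)
Let row_bound i k q (A : mR * mR -> R) j : Q q -> W i = W k -> l k = 0 ->
  V k q != 0 ->
  (forall i, leb.-integrable setT (fun z => (G i 2 (q, z))%:E)) ->
  {ae leb, forall z, K z -> F k (q, z) = p k + \int[leb]_(s in `]0, z]) G k 2
      (q, s)} ->
  {ae leb, forall z, K z -> G i j (q, z) = W i z * A q} ->
  exists C : R, 0 <= C /\ {ae leb, forall z, K z -> `|G i j (q, z)| <= C * S q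
      z}.
Proof.
move=> Qq Wik lk Vk iq Fk Gij; exists (`|A q| / `|V k q|).
split; first by rewrite divr_ge0.
apply: ae_imp (ae_and Fk Gij) => z [+ +] Kz => /(_ Kz) + /(_ Kz) ->.
rewrite FWV// p_eq0// add0r -Wik normrM => WV.
rewrite mulrAC -mulrA [_ * `|A q|]mulrC ler_wpM2l// ler_pdivlMr ?normr_gt0//.
rewrite -normrM WV.
have mz : measurable (`]0, z] : set mR) by exact: measurable_itv.
have iz : leb.-integrable `]0, z] (EFin \o (fun t => G k 2 (q, t))).
  by apply: integrableS (iq k).
apply: le_trans (le_normr_Rintegral mz iz) _.
apply: le_Rintegral => //.
- exact: integrable_norm.
- by apply: integrableS (integrable_s iq).
- by move=> t _; rewrite /s (bigD1 k)//= lerDl sumr_ge0.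
Qed.

Let integrable_vert : {ae leb2s R, forall q, Q q ->
  forall i, leb.-integrable setT (fun z => (G i 2 (q, z))%:E)}.
Proof.
apply: ae_imp (ae_andD (vert 0) (ae_andD (vert 1) (vert 2))).
by move=> q + Qq => /(_ Qq)[[i0 _] [[i1 _] [i2 _]]]; elim/ord3_ind.
Qed.

Let zero_row_bound i q j : {ae leb, forall z, K z -> G i j (q, z) = 0} ->
  exists C : R, 0 <= C /\ {ae leb, forall z, K z -> `|G i j (q, z)| <= C * S q
      z}.
Proof.
move=> G0; exists 0; split=> //; apply: ae_imp G0 => z + Kz => -> //.
by rewrite normr0 mul0r.
Qed.

Hypothesis V01 : forall q, Q q -> V 0 q != 0 \/ V 1 q != 0.

Let ae_row_bound i j : j != 2 -> {ae leb2s R, forall q, Q q ->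
  exists C : R, 0 <= C /\ {ae leb, forall z, K z -> `|G i j (q, z)| <= C * S q
      z}}.
Proof.
move=> j2.
have [A GA] := @slices_proportional R a b c d (F i) (G i) (u i) (p i) ab cd
  (mF i) (iG i) (Cu i) (@small i) (W i) (V i) j j2 (mW i) (@FWV i).
have vF k : {ae leb2s R, forall q, Q q -> {ae leb, forall z, K z ->
    F k (q, z) = p k + \int[leb]_(s in `]0, z]) G k 2 (q, s)}}.
  by apply: ae_imp (vert k) => q + Qq => /(_ Qq)[].
have [i2|Wi0] : i = 2 \/ W i = W 0.
- by elim/ord3_ind: i {A GA}; [right|right|left].
- subst i; have [l2|l2] := eqVneq (l 2) 0; last first.
    apply: ae_imp (constant_eq0 l2 j2) => q + Qq => /(_ Qq); exact:
        zero_row_bound.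
  have [V2n|W20] := V2.
    apply: ae_imp (ae_andD integrable_vert (ae_andD (vF 2) GA)).
    move=> q + Qq => /(_ Qq)[iq [Fq Gq]].
    exact: (row_bound Qq erefl l2 (V2n q Qq) iq Fq Gq).
  apply: ae_imp GA => q + Qq => /(_ Qq) Gq; apply: zero_row_bound.
  by apply: ae_imp Gq => z + Kz => ->//; rewrite W20 mul0r.
apply: ae_imp (ae_andD integrable_vert (ae_andD (vF 0) (ae_andD (vF 1) GA))).
move=> q + Qq => /(_ Qq)[iq [F0q [F1q Gq]]].
have [V0|V1] := V01 Qq.
  exact: (row_bound Qq Wi0 l0 V0 iq F0q Gq).
have Wi1 : W i = W 1 by rewrite Wi0.
have l1 : l 1 = 0 by rewrite -l01.
exact: (row_bound Qq Wi1 l1 V1 iq F1q Gq).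
Qed.

Let ae_column_bound j : j != 2 -> {ae leb2s R, forall q, Q q ->
  exists C : R, 0 <= C /\
    {ae leb, forall z, K z -> \sum_(i < 3) `|G i j (q, z)| <= C * S q z}}.
Proof.
move=> j2; apply: ae_imp (ae_andD (ae_row_bound 0 j2)
  (ae_andD (ae_row_bound 1 j2) (ae_row_bound 2 j2))).
move=> q + Qq => /(_ Qq)[[x [x0 bx]] [[y [y0 b_y]] [z [z0 bz]]]].
exists (x + y + z); split; first by rewrite !addr_ge0.
apply: ae_imp (ae_andD bx (ae_andD b_y bz)) => t + Kt => /(_ Kt)[? [? ?]].
by rewrite sum3E !mulrDl !lerD.
Qed.

Lemma box_contradiction : False.
Proof.
have o02 : (0 : 'I_3) != 2 by []. have o12 : (1 : 'I_3) != 2 by [].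
have irho_q : {ae leb2s R, forall q, Q q ->
    leb.-integrable setT (fun z => (rho (q, z))%:E)}.
  apply: ae_imp (@ae_integrable1 _ _ _ _ _ (leb2s R) (lebs R) (EFin \o rho)
      irho).
  by move=> q.
have [q Qq [dq [iq [rq [[x [x0 bx]] [y [y0 b_y]]]]]]] := aeQ (ae_andD ae_det
  (ae_andD integrable_vert (ae_andD irho_q
  (ae_andD (ae_column_bound o02) (ae_column_bound o12))))).
have is_q := integrable_s iq.
have is_z z : leb.-integrable `]0, z] (EFin \o s q) by exact: integrableS is_q.
have S_mono y1 y2 : y1 <= y2 -> S q y1 <= S q y2.
  move=> y12; rewrite -lee_fin /S /Rintegral !fineK; try exact:
      integrable_fin_num.
  apply: ge0_subset_integral => //.
  - by have /integrableP[] := is_z y2.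
  - by move=> t _; rewrite lee_fin.
  - by apply: subset_itvl; rewrite bnd_simp.
(* [x] and [y] bound the two horizontal columns, and x y <= (x + y)^2. *)
pose C := x + y.
(* From s^3 <= rho D and D <= C^2 S^2 s follows s^2 <= C^2 rho S^2, while D > 0 forces s and S to be
   positive. The square root of k = C^2 rho is replaced by 1 + k, which is integrable on the bounded
   line. *)
have main : {ae leb, forall z, K z -> 0 < S q z /\
    s q z <= (1 + C ^+ 2 * rho (q, z)) * S q z}.
  apply: ae_imp (ae_andD dq (ae_andD bx b_y)) => z + Kz => /(_ Kz).
  set D := \det _ => -[[D0 sD] [Xz Yz]].
  have DXY := det3_le (\matrix_(i, j) G i j (q, z)).
  rewrite -/D in DXY.
  have DXY' : D <= (\sum_(i < 3) `|G i 0 (q, z)|) *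
      (\sum_(i < 3) `|G i 1 (q, z)|) * s q z.
    move: DXY; rewrite (eq_bigr (fun i => `|G i 0 (q, z)|)); last first.
      by move=> i _; rewrite mxE.
    rewrite [X in _ * X * _](eq_bigr (fun i => `|G i 1 (q, z)|)); last first.
      by move=> i _; rewrite mxE.
    by rewrite [X in _ * _ * X](eq_bigr (fun i => `|G i 2 (q, z)|))// => i _;
        rewrite mxE.
  move: DXY' Xz Yz sD (s0 q z) (S0 q z) (rho0 (q, z)); rewrite -/(s q z).
  set X := \sum_(i < 3) _; set Y := \sum_(i < 3) _.
  have : 0 <= X by rewrite sumr_ge0.
  have : 0 <= Y by rewrite sumr_ge0.
  move: (s q z) (S q z) (rho (q, z)) X Y => t T r X Y Y0 X0 DXYt XT YT tD t0 T0
      r0.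
  have CT : D <= C ^+ 2 * T ^+ 2 * t.
    apply: (le_trans DXYt); rewrite ler_wpM2r//.
    apply: (le_trans (ler_pM X0 Y0 XT YT)).
    rewrite mulrACA -expr2 ler_wpM2r ?sqr_ge0//.
    by rewrite /C expr2; nra.
  have t_gt0 : 0 < t.
    rewrite lt_neqAle t0 andbT; apply/eqP => tE; move: CT D0.
    by rewrite -tE mulr0 => /le_lt_trans h /h; rewrite ltxx.
  have T_gt0 : 0 < T.
    rewrite lt_neqAle T0 andbT; apply/eqP => TE; move: CT D0.
    by rewrite -TE expr0n/= mulr0 mul0r => /le_lt_trans h /h; rewrite ltxx.
  split=> //; rewrite -ler_sqr ?nnegrE//; last first.
    by rewrite mulr_ge0// addr_ge0// mulr_ge0// sqr_ge0.
  have k0 : 0 <= C ^+ 2 * r by rewrite mulr_ge0// sqr_ge0.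
  have : t ^+ 2 <= C ^+ 2 * r * T ^+ 2.
    rewrite -(ler_pM2r t_gt0) -exprSr (le_trans tD)//.
    rewrite (_ : _ * t = r * (C ^+ 2 * T ^+ 2 * t)); last by ring.
    by rewrite ler_wpM2l.
  move=> /le_trans; apply; rewrite exprMn ler_wpM2r ?sqr_ge0//.
  by move: (C ^+ 2 * r) k0 => k k0; nra.
apply: (@no_integrable_log_derivative R (s q) (fun z => 1 + C ^+ 2 * rho (q,
    z))).
- by move=> z; exact: s0.
- by move=> z; rewrite addr_ge0// mulr_ge0// sqr_ge0.
- exact: integrableS is_q.
- have i1 : leb.-integrable `]0, 1[ (EFin \o cst (1 : R)).
    have h := continuous_compact_integrable (@segment_compact _ (0 : R) 1)
      (continuous_subspaceT (@cst_continuous _ _ (1 : R))).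
    by apply: integrableS h => //; exact: subset_itv_oo_cc.
  have mK : measurable (`]0, 1[ : set mR) by exact: measurable_itv.
  have i2 := integrableZl mK (C ^+ 2) (integrableS measurableT mK (@subsetT _
      _) rq).
  by apply: eq_integrable (integrableD mK i1 i2).
(* Positivity of [S q] is known almost everywhere; a point [z1] below [z] and monotonicity give it
   at every height. *)
- move=> z Kz; have [z1] : exists2 z1, z1 \in `]0, z[ & 0 < S q z1.
    move: Kz; rewrite in_itv/= => /andP[z0 z1]; apply: ae_ex_itv => //.
    apply: ae_imp main => t + tz; move: tz; rewrite in_itv/= => /andP[t0 tz].
    by move=> h; apply: (h _).1; rewrite /K/= in_itv/= t0 (lt_trans tz).
  by rewrite in_itv/= => /andP[_ /ltW/S_mono] zz /lt_le_trans; exact.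
- by apply: ae_imp main => z + Kz => /(_ Kz)[].
Qed.

End box.

(** * Tools for the reduction: operator norm, monotone profiles, polar angle, minorants *)

Lemma opnorm_ge_entry (R : realType) n (A : 'M[R]_n) i j : `|A i j| <= opnorm A.
Proof.
have entry_le (x : 'cV[R]_n) k : `|x k 0| <= enorm x.
  rewrite -sqrtr_sqr /enorm ler_wsqrtr// (bigD1 k)//= lerDl sumr_ge0// => *.
  exact: sqr_ge0.
(* The bound ensures that [sup] is a genuine supremum and not its default value. *)
have ub : has_ubound [set enorm (A *m x) | x in [set x : 'cV[R]_n | enorm x <=
    1]].
  exists (Num.sqrt (\sum_(k < n) (\sum_(m < n) `|A k m|) ^+ 2)).
  move=> _ [x /= x1 <-]; rewrite /enorm ler_wsqrtr// ler_sum// => k _.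
  rewrite -real_normK ?num_real// ler_sqr ?nnegrE ?sumr_ge0//.
  rewrite mxE (le_trans (ler_norm_sum _ _ _))// ler_sum// => m _.
  by rewrite normrM ler_piMr// (le_trans (entry_le x m)).
apply: (@le_trans _ _ (enorm (A *m delta_mx j 0))).
  have -> : A i j = (A *m delta_mx j 0 : 'cV_n) i 0 by rewrite -colE mxE.
  exact: entry_le.
apply: ub_le_sup => //; exists (delta_mx j 0) => //=.
rewrite /enorm (bigD1 j)//= big1; last first.
  by move=> k kj; rewrite mxE (negbTE kj) expr0n.
by rewrite mxE !eqxx expr1n addr0 sqrtr1.
Qed.

(** Between two zeros a monotone function vanishes; if there is a single zero, the interval to its
    right avoids it. *)
Lemma monotonic_zero_dichotomy (R : realType) (v : R -> R) (I : interval R)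
    (x y : R) : monotonic_on I v -> {subset `]x, y[ <= I} -> x < y ->
  exists x' y', [/\ x <= x', x' < y', y' <= y &
    (forall r, r \in `]x', y'[ -> v r != 0) \/
    (forall r, r \in `]x', y'[ -> v r = 0)].
Proof.
move=> vI sI xy.
have [[r rxy vr]|no] := pselect (exists2 r, r \in `]x, y[ & v r = 0); last
    first.
  exists x, y; split=> //; left => r rxy; apply/eqP => vr.
  by apply: no; exists r.
move: (rxy); rewrite in_itv/= => /andP[xr ry].
have [[t tr vt]|no] := pselect (exists2 t, t \in `]r, y[ & v t = 0); last first.
  exists r, y; split=> //; [exact: ltW|left => t tr; apply/eqP => vt].
  by apply: no; exists t.
move: (tr); rewrite in_itv/= => /andP[rt ty].
exists r, t; split=> //; [exact: ltW|exact: ltW|right => m].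
rewrite in_itv/= => /andP[rm mt].
have rI : r \in I by exact: sI.
have tI : t \in I by apply: sI; rewrite in_itv/= ty (lt_trans xr).
have mI : m \in I by apply: sI; rewrite in_itv/= (lt_trans xr)// (lt_trans mt).
apply/eqP; rewrite eq_le.
by case: vI => mono; have := mono _ _ rI mI (ltW rm);
  have := mono _ _ mI tI (ltW mt); rewrite vr vt => -> ->.
Qed.

(** Composing with the projection onto [0, 1] gives a function monotone on the whole line, hence
    measurable and with a right limit at 0; this limit may differ from [w 0]. *)
Lemma monotonic_extension (R : realType) (w : R -> R) :
  monotonic_on `[0, 1] w -> exists (w' : R -> R) (k : R),
  [/\ measurable_fun [set: measurableTypeR R] (w' : measurableTypeR R -> R),
      forall z, z \in `[0, 1] -> w' z = w z & w' z @[z --> (0 : R)^'+] --> k].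
Proof.
pose clamp (z : R) := Num.max 0 (Num.min z 1).
have clamp01 z : clamp z \in `[0, 1].
  by rewrite in_itv/= le_max lexx/= ge_max ler01 ge_min lexx orbT.
have clamp_id z : z \in `[0, 1] -> clamp z = z.
  by rewrite in_itv/= /clamp => /andP[z0 z1]; rewrite (min_idPl _)// (max_idPr
      _).
have clamp_mono : {homo clamp : x y / x <= y}.
  move=> x y xy; rewrite /clamp ge_max; apply/andP; split; rewrite le_max
      ?lexx//.
  by apply/orP; right; rewrite le_min !ge_min xy lexx orbT.
have nondec (v : R -> R) : {in `[0, 1] &, nondecreasing_fun v} ->
    exists (w' : R -> R) (k : R),
    [/\ measurable_fun [set: measurableTypeR R] (w' : measurableTypeR R -> R),
      forall z, z \in `[0, 1] -> w' z = v z & w' z @[z --> (0 : R)^'+] --> k].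
  move=> mono; have homo : {homo v \o clamp : x y / x <= y}.
    by move=> x y xy; apply: mono; [exact: clamp01..|exact: clamp_mono].
  exists (v \o clamp), (inf [set (v \o clamp) x | x in [set` `]0, 1[]]); split.
  - exact: (nondecreasing_measurable measurableT homo).
  - by move=> z z01 /=; rewrite clamp_id.
  apply: nondecreasing_at_right_cvgr; rewrite ?bnd_simp//.
    by move=> x y _ _; exact: homo.
  exists (v 0) => _ [z z01 <-] /=; apply: mono; rewrite ?in_itv/= ?lexx
      ?ler01//.
  - exact: clamp01.
  - by have := clamp01 z; rewrite in_itv/= => /andP[].
case=> [/nondec//|noninc].
have incN : {in `[0, 1] &, nondecreasing_fun (fun z => - w z)}.
  by move=> x y xI yI xy; rewrite lerN2; exact: noninc.
have [w' [k [mw' w'E w'k]]] := nondec _ incN.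
exists (fun z => - w' z), (- k); split.
- exact: measurableT_comp.
- by move=> z zI; rewrite w'E// opprK.
- exact: cvgN.
Qed.

(** The value of [acos] has a nonnegative sine, so in this quadrant it is the polar angle without
    case distinction. *)
Lemma polar_first_quadrant (R : realType) (x y : R) : 0 < x -> 0 < y ->
  let r := Num.sqrt (x ^+ 2 + y ^+ 2) in
  [/\ 0 < r, acos (x / r) \in `[0, 2 * pi[,
      r * cos (acos (x / r)) = x & r * sin (acos (x / r)) = y].
Proof.
move=> x0 y0 r.
have r0 : 0 < r by rewrite sqrtr_gt0 addr_gt0// exprn_gt0.
have r2 : r ^+ 2 = x ^+ 2 + y ^+ 2 by rewrite sqr_sqrtr// addr_ge0// sqr_ge0.
have xler : x <= r.
  by rewrite -ler_sqr ?nnegrE ?(ltW x0) ?(ltW r0)// r2 lerDl sqr_ge0.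
have xr : -1 <= x / r <= 1.
  rewrite ler_pdivrMr// mul1r xler andbT.
  by apply: (@le_trans _ _ 0); [lra|rewrite divr_ge0// ltW].
split=> //.
- rewrite in_itv/= acos_ge0//= (le_lt_trans (acos_lepi xr))//.
  by rewrite ltr_pMl ?pi_gt0// ltr1n.
- by rewrite acosK ?in_itv// mulrC divfK// gt_eqF.
rewrite sin_acos//.
have -> : 1 - (x / r) ^+ 2 = (y / r) ^+ 2.
  have rn0 : r != 0 by rewrite gt_eqF.
  rewrite !expr_div_n r2; field; rewrite -r2; exact: expf_neq0.
by rewrite sqrtr_sqr ger0_norm ?divr_ge0 ?ltW// mulrC divfK// gt_eqF.
Qed.

(** The integral of a nonnegative function is a supremum over simple functions below it, so it is
    monotone even where measurability is unknown, as for the energy density. *)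
Lemma ge0_le_integral_nomeasurability d (T : measurableType d) (R : realType)
    (mu : {measure set T -> \bar R}) (f g : T -> \bar R) :
  (forall x, 0 <= f x)%E -> (forall x, f x <= g x)%E ->
  (\int[mu]_x f x <= \int[mu]_x g x)%E.
Proof.
move=> f0 fg; rewrite !ge0_integralTE//; last first.
  by move=> x; exact: le_trans (fg x).
apply: ereal_sup_le => _ [h hf <-]; exists h => // x.
exact: le_trans (hf x) (fg x).
Qed.

Lemma integrable_minorant d (T : measurableType d) (R : realType)
    (mu : {measure set T -> \bar R}) (D : set T) (f g : T -> R) :
  measurable_fun setT g -> (forall x, 0 <= g x) -> (forall x, ~ D x -> g x = 0)
      ->
  {ae mu, forall x, D x -> g x <= f x} ->
  (\int[mu]_(x in D) (f x)%:E)%E <> +oo%E ->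
  mu.-integrable setT (EFin \o g).
Proof.
move=> mg g0 gD [N [mN N0 fgN]] fD.
have fg x : ~ N x -> D x -> g x <= f x.
  by move=> Nx Dx; apply: contrapT => h; apply: Nx; apply: fgN => /= /(_ Dx).
pose F := (EFin \o f) \_ D.
(* The negative part of [F] lives on the null set [N], where it is bounded by +oo; its integral is
   therefore 0. *)
have Fm0 : (\int[mu]_x F^\- x = 0)%E.
  apply/eqP; rewrite eq_le integral_ge0 ?andbT => [|x _]; last exact:
      funeneg_ge0.
  apply: (@le_trans _ _ (\int[mu]_x ((cst +oo%E \_ N) x))%E).
    apply: ge0_le_integral_nomeasurability => x; first exact: funeneg_ge0.
    rewrite patchE; case: ifPn => [_|/negP xN]; first exact: leey.
    rewrite funenegE /F patchE; case: ifPn => xD; last by rewrite oppe0 maxxx.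
    rewrite ge_max lexx andbT /= lee_fin oppr_le0.
    by rewrite (le_trans (g0 x))// fg//; [move=> /mem_set|exact: set_mem].
  by rewrite -integral_mkcond integral_cst// [X in (_ * X)%E]N0 mule0.
have gFp : (\int[mu]_x (g x)%:E <= \int[mu]_x F^\+ x)%E.
  rewrite (ge0_negligible_integral mN)//; last 2 first.
  - exact/measurable_EFinP.
  - by move=> x _; rewrite lee_fin.
  rewrite integral_mkcond; apply: ge0_le_integral_nomeasurability => x.
    by apply: erestrict_ge0 => y _; rewrite lee_fin.
  rewrite patchE; case: ifPn => [|_]; last exact: funepos_ge0.
  rewrite in_setD => /andP[_ /negP xN]; rewrite funeposE /F patchE.
  case: ifPn => [xD|/negP xD]; last by rewrite gD ?le_max ?lexx// => /mem_set.
  rewrite le_max; apply/orP; left; rewrite lee_fin fg//; [|exact: set_mem].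
  by move=> /mem_set.
apply/integrableP; split; first exact/measurable_EFinP.
under eq_integral do rewrite /= ger0_norm//.
apply: (le_lt_trans gFp); rewrite ltey; apply/eqP => Fp; apply: fD.
by rewrite integral_mkcond -/F integralE Fp Fm0 sube0.
Qed.

Lemma cvg0_eventually_lt (R : realType)
    (k : nat -> \bar R) (e : R) : 0 < e -> k n @[n --> \oo] --> 0%E ->
  \forall n \near \oo, (k n < e%:E)%E.
Proof.
move=> e0 k0; apply: (k0 [set x | (x < e%:E)%E]).
apply: open_nbhs_nbhs; split; first exact: open_ereal_lt_ereal.
by rewrite /= lte_fin.
Qed.

(** * Reduction of the theorem to a box *)

Theorem proposition1 (R : realType)
    (f : R * R * R -> R * R * R) (Df : R * R * R -> 'M[R]_3)
    (T : R * R -> R * R * R) (w v g h l : R -> R)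
    (f_W11 : W11 (interior (cylinder R)) f Df)
    (f_axi : axisymmetric_fun (cylinder R) f)
    (f_or : orientation_preserving (cylinder R) Df)
    (f_cyl : forall i, cylindrical_product (cylinder R) (fun x => coord3 i (f
        x)))
    (f_form : forall r theta z : R,
        r \in `]0, 1[ -> theta \in `[0, 2 * pi[ -> z \in `[0, 1] ->
        f (r * cos theta, r * sin theta, z) =
        (w z * v r * cos (g theta), w z * v r * sin (g theta), h z * l r))
    (w_mono : monotonic_on `[0, 1] w)
    (v_mono : monotonic_on `]0, 1[ v)
    (h_mono : monotonic_on `[0, 1] h)
    (l_mono : monotonic_on `]0, 1[ l)
    (g_mono : {in `[0, 2 * pi[ &, nondecreasing_fun g})
    (w_conv : concave_on `[0, 1] w \/ convex_on `[0, 1] w)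
    (h_conv : concave_on `[0, 1] h \/ convex_on `[0, 1] h)
    (f_trace : base_trace f Df T)
    (f_point : exists p : R * R * R,
        {ae leb2 R, forall q, disc R q -> T q = p}) :
  (\int[leb3 R]_(x in cylinder R)
      (opnorm (Df x) ^+ 3 / \det (Df x))%:E = +oo)%E.
Proof.
apply: contrapT => finite_energy.
have [r1 [r2 [r1_gt0 r12 r2_lt1 v0 l0]]] : exists r1 r2 : R,
  [/\ 0 < r1, r1 < r2, r2 < 1,
    (forall r, r \in `]r1, r2[ -> v r != 0) \/
    (forall r, r \in `]r1, r2[ -> v r = 0) &
    (forall r, r \in `]r1, r2[ -> l r != 0) \/
    (forall r, r \in `]r1, r2[ -> l r = 0)].
  have s1 : {subset `](1 / 4 : R), 3 / 4[ <= `]0, 1[}.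
    by move=> r; rewrite !in_itv/= => /andP[? ?]; apply/andP; split; lra.
  have lt1 : 1 / 4 < 3 / 4 :> R by lra.
  have [x [y [x1 xy y1 v0]]] := monotonic_zero_dichotomy v_mono s1 lt1.
  have s2 : {subset `]x, y[ <= `]0, 1[}.
    by move=> r; rewrite !in_itv/= => /andP[? ?]; apply/andP; split; lra.
  have [x' [y' [x1' xy' y1' l0]]] := monotonic_zero_dichotomy l_mono s2 xy.
  exists x', y'; split=> //; [lra|lra|].
  have s3 r : r \in `]x', y'[ -> r \in `]x, y[.
    by rewrite !in_itv/= => /andP[? ?]; apply/andP; split; lra.
  by case: v0 => v0; [left|right] => r /s3; exact: v0.
(* As b + d = r2, the points of ]0, b[ x ]r1, d[ have radius between r1 and r2. *)
pose b := (r2 - r1) / 2; pose d := (r1 + r2) / 2.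
have b0 : 0 < b by rewrite /b; lra.
have r1d : r1 < d by rewrite /d; lra.
pose I : set (measurableTypeR R) := `]0, b[%classic.
pose J : set (measurableTypeR R) := `]r1, d[%classic.
pose K : set (measurableTypeR R) := `]0, 1[%classic.
pose Q : set (measurableTypeR R * measurableTypeR R) := I `*` J.
pose B : set (measurableTypeR R * measurableTypeR R * measurableTypeR R) := Q
    `*` K.
have mB : measurable B.
  by apply: measurableX; [apply: measurableX|]; exact: measurable_itv.
have mQ : measurable Q by apply: measurableX; exact: measurable_itv.
pose rad (q : R * R) := Num.sqrt (q.1 ^+ 2 + q.2 ^+ 2).
pose ang (q : R * R) := acos (q.1 / rad q).
have Q_polar q : Q q -> [/\ rad q \in `]r1, r2[, ang q \in `[0, 2 * pi[,
    q.1 = rad q * cos (ang q) & q.2 = rad q * sin (ang q)].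
  move=> [] /=; rewrite /I /J /= !in_itv/= => /andP[q10 q1b] /andP[q2r q2d].
  have [_ ? h1 h2] := polar_first_quadrant q10 (lt_trans r1_gt0 q2r).
  split=> //.
  have r10 := ltW r1_gt0; have r20 : 0 <= r2 by lra.
  move: q1b q2d; rewrite /b /d => q1b q2d.
  apply/andP; split; rewrite -ltr_sqr ?nnegrE ?sqrtr_ge0// sqr_sqrtr
    ?addr_ge0 ?sqr_ge0//; nra.
have rad01 r : r \in `]r1, r2[ -> r \in `]0, 1[.
  by rewrite !in_itv/= => /andP[? ?]; apply/andP; split; lra.
have Q_disc q : Q q -> disc R q.
  case: q => q1 q2 /Q_polar[/rad01 + _ _ _]; rewrite in_itv/= => /andP[rad0
      rad1].
  rewrite /disc/= -[X in X < _](@sqr_sqrtr _ (q1 ^+ 2 + q2 ^+ 2)).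
    by rewrite -[ltRHS](expr1n _ 2) ltr_sqr ?nnegrE// ltW.
  by rewrite addr_ge0// sqr_ge0.
have K01 z : K z -> z \in `[0, 1].
  by rewrite /K/= !in_itv/= => /andP[/ltW-> /ltW->].
have B_cyl : B `<=` cylinder R.
  by move=> [q z] [/= Qq Kz]; split; [exact: Q_disc|exact: K01].
have B_int : B `<=` (cylinder R)°.
  move=> [[q1 q2] z] [/= [Iq1 Jq2] Kz]; apply: filterS B_cyl _.
  have nitv (a c t : R) : t \in `]a, c[ -> nbhs t `]a, c[%classic.
    by move=> tac; apply: open_nbhs_nbhs; split => //; exact: interval_open.
  exists (Q, K); last by case=> [[? ?] ?] [].
  split; last exact: nitv.
  by exists (I, J); [split; exact: nitv|case=> [? ?] []].

have mcyl : measurable ((cylinder R)° : set (measurableTypeR R *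
    measurableTypeR R * measurableTypeR R)).
  by apply: open3_measurable; exact: open_interior.
have [f_int Df_int _] := f_W11.
(* Extension by zero makes [F] and [G] integrable on the whole space, the form in which Tonelli is
   applied to them. *)
pose F (i : 'I_3) : measurableTypeR R * measurableTypeR R * measurableTypeR R
    -> R :=
  (fun x => coord3 i (f x)) \_ B.
pose G (i j : 'I_3) : measurableTypeR R * measurableTypeR R * measurableTypeR R
    -> R :=
  (fun x => Df x i j) \_ B.
have iF i : (leb3 R).-integrable setT (EFin \o F i).
  rewrite -restrict_EFin -integrable_mkcond//.
  exact: integrableS (f_int i).
have iG i j : (leb3 R).-integrable setT (EFin \o G i j).
  rewrite -restrict_EFin -integrable_mkcond//.
  exact: integrableS (Df_int i j).
have mF i : measurable_fun setT (F i).
  by have /integrableP[/measurable_EFinP] := iF i.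
have mG i j : measurable_fun setT (G i j).
  by have /integrableP[/measurable_EFinP] := iG i j.
have [p Tp] := f_point.
have [u uP] := choice (fun i => (f_trace i).2).
have Cu i n : Ck 1 (u i n) by have [+ _ _ _] := uP i; apply.
have mdisc : measurable (disc R : set (measurableTypeR R * measurableTypeR R)).
  have mr : measurable_fun setT
      (fun q : measurableTypeR R * measurableTypeR R => q.1 ^+ 2 + q.2 ^+ 2 :
          R).
    by apply: measurable_funD; exact: measurable_funX.
  have := mr measurableT `]-oo, (1 : R)[%classic (measurable_itv _).
  by rewrite setTI (_ : _ @^-1` _ = disc R)//; apply/seteqP; split=> q;
    rewrite /disc/= in_itv.
have mu i n : measurable_fun [set: measurableTypeR R * measurableTypeR R *
    measurableTypeR R] (u i n).
  by apply: continuous3_measurable; exact: Ck1_continuous.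
have mDu i n j : measurable_fun [set: measurableTypeR R * measurableTypeR R *
    measurableTypeR R] (fun x => 'D_(basis3 j) (u i n) x).
  by apply: continuous3_measurable; exact: Ck1_partial_continuous.
have le_box (k e : measurableTypeR R * measurableTypeR R * measurableTypeR R ->
    R) :
    measurable_fun setT k -> (leb3 R).-integrable (cylinder R)° (EFin \o e) ->
    (\int[leb3 R]_(x in B) `|k x - (e \_ B) x|%:E <=
     \int[leb3 R]_(x in (cylinder R)°) `|k x - e x|%:E)%E.
  move=> mk /integrableP[/measurable_EFinP me _].
  rewrite [leLHS](eq_integral (fun x => `|k x - e x|%:E)); last first.
    by move=> x xB; rewrite patchE xB.
  apply: (@ge0_subset_integral _ _ _ (prod_sf (leb2s R) (lebs R))) => //.
  apply/measurable_EFinP; apply: measurableT_comp => //.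
  by apply: measurable_funB => //; exact: measurable_funTS.
have small i (e : R) : 0 < e -> exists n,
    (\int[leb3 R]_(x in B) (`|u i n x - F i x| +
       \sum_(j < 3) `|'D_(basis3 j) (u i n) x - G i j x|)%:E < e%:E)%E /\
    (\int[leb2 R]_(q in Q) `|u i n (q, 0 : R) - coord3 i p|%:E < e%:E)%E.
  (* One quarter for the values and one for each of the three partial derivatives. *)
  move=> e0; have e4 : 0 < e / 4 by rewrite divr_gt0.
  have [_ c0 c1 c2] := uP i.
  have E0 := cvg0_eventually_lt e4 c0.
  have E1 j := cvg0_eventually_lt e4 (c1 j).
  have E2 := cvg0_eventually_lt e0 c2.
  have [n [n0 [n1 [n2 [n3 n4]]]]] :=
    filter_ex (filterI E0 (filterI (E1 0) (filterI (E1 1) (filterI (E1 2)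
        E2)))).
  have {}n0 := le_lt_trans (le_box _ _ (mu i n) (f_int i)) n0.
  have {}n1 := le_lt_trans (le_box _ _ (mDu i n 0) (Df_int i 0)) n1.
  have {}n2 := le_lt_trans (le_box _ _ (mDu i n 1) (Df_int i 1)) n2.
  have {}n3 := le_lt_trans (le_box _ _ (mDu i n 2) (Df_int i 2)) n3.
  exists n; split.
    have md (k1 k2 : measurableTypeR R * measurableTypeR R *
        measurableTypeR R -> R) : measurable_fun setT k1 -> measurable_fun setT
            k2 ->
        measurable_fun B (fun x => `|k1 x - k2 x|%:E).
      move=> mk1 mk2; apply/measurable_EFinP; apply: measurable_funTS.
      by apply: measurableT_comp => //; exact: measurable_funB.
    under eq_integral do rewrite sum3E !EFinD.
    have mD j := md _ _ (mDu i n j) (mG i j).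
    have mU := md _ _ (mu i n) (mF i).
    rewrite !(@ge0_integralD _ _ _ (prod_sf (leb2s R) (lebs R)))//;
      try (by do ?apply: emeasurable_funD);
      try (by move=> x _; rewrite -!EFinD lee_fin !addr_ge0).
    rewrite (_ : e = e / 4 + (e / 4 + e / 4 + e / 4)); last by field.
    by rewrite !EFinD; do ?apply: lteD.
  apply: (le_lt_trans _ n4).
  have mu0 : measurable_fun setT
      (fun q : measurableTypeR R * measurableTypeR R => u i n (q, 0 : R)).
    by apply: measurableT_comp (mu i n) _; exact: pair2_measurable.
  have [iT _] := f_trace i; have /integrableP[/measurable_EFinP mT _] := iT.
  have mk : measurable_fun (disc R : set (measurableTypeR R * measurableTypeR
      R))
      (fun q : measurableTypeR R * measurableTypeR R =>
        `|u i n (q, 0 : R) - coord3 i (T q)|%:E).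
    apply/measurable_EFinP; apply: measurableT_comp => //.
    by apply: measurable_funB => //; exact: measurable_funTS.
  have -> : (\int[leb2 R]_(q in Q) `|u i n (q, 0 : R) - coord3 i p|%:E =
      \int[leb2 R]_(q in Q) `|u i n (q, 0 : R) - coord3 i (T q)|%:E)%E.
    apply: (@ae_eq_integral _ _ _ (leb2s R)) => //.
    - apply/measurable_EFinP; apply: measurable_funTS.
      by apply: measurableT_comp => //; exact: measurable_funB.
    - exact: measurable_funS mk.
    - by apply: ae_imp Tp => q Tq Qq; rewrite Tq//; exact: Q_disc.
  by apply: (@ge0_subset_integral _ _ _ (leb2s R)).
have [w' [wk [mw' w'E w'k]]] := monotonic_extension w_mono.
have [h' [hk [mh' h'E h'k]]] := monotonic_extension h_mono.
(* If [l] vanishes on ]r1, r2[, the third component is zero on the box and its vertical profile may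
   be taken to be 0. *)
have [hh [hhk [mhh hhE hhk_lim hh0]]] : exists (hh : R -> R) (k : R),
    [/\ measurable_fun [set: measurableTypeR R] (hh : measurableTypeR R -> R),
      forall q z, Q q -> K z -> h z * l (rad q) = hh z * l (rad q),
      hh z @[z --> (0 : R)^'+] --> k &
      (forall q, Q q -> l (rad q) != 0) \/ (forall z, hh z = 0)].
  case: l0 => l0.
    exists h', hk; split=> //; first by move=> q z _ Kz; rewrite h'E// K01.
    by left=> q /Q_polar[/l0].
  exists (cst 0), 0; split=> //; [|exact: cvg_cst|by right].
  by move=> q z /Q_polar[/l0 -> _ _ _] _; rewrite !mulr0.
pose V (i : 'I_3) (q : measurableTypeR R * measurableTypeR R) : R :=
  tnth [tuple v (rad q) * cos (g (ang q)); v (rad q) * sin (g (ang q));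
              l (rad q)] i.
pose W (i : 'I_3) : measurableTypeR R -> R := if i == 2 then hh else w'.
pose k (i : 'I_3) : R := if i == 2 then hhk else wk.
have mW i : measurable_fun setT (W i) by rewrite /W; case: ifP.
have Wk i : W i z @[z --> (0 : R)^'+] --> k i by rewrite /W /k; case: ifP.
have FWV i q z : Q q -> K z -> F i (q, z) = W i z * V i q.
  move=> Qq Kz; rewrite /F patchE mem_set//; have [rq aq q1 q2] := Q_polar q Qq.
  have -> : (q, z) = (rad q * cos (ang q), rad q * sin (ang q), z) :> R * R * R.
    by rewrite -q1 -q2 -surjective_pairing.
  rewrite f_form//; [|exact: rad01|exact: K01].
  rewrite -(w'E z (K01 z Kz)) (hhE q z Qq Kz).
  by elim/ord3_ind: i; rewrite /coord3 /V /W !(tnth_nth 0)/= ?mulrA.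
pose s (x : measurableTypeR R * measurableTypeR R * measurableTypeR R) : R :=
  \sum_(i < 3) `|G i 2 x|.
pose D (x : measurableTypeR R * measurableTypeR R * measurableTypeR R) : R :=
  \det (\matrix_(i, j) G i j x).
(* A measurable minorant of the energy density: 27 = 3^3 because [s] is a sum of three entries, each
   at most the operator norm. Off the box [s], and with it [rho1], is zero. *)
pose rho1 (x : measurableTypeR R * measurableTypeR R * measurableTypeR R) : R :=
  Num.max 0 (s x ^+ 3 * (27 * D x) `^ (-1)).
have DE x : B x -> D x = \det (Df x).
  move=> Bx; congr (\det _); apply/matrixP => i j.
  by rewrite mxE /G patchE mem_set.
have mD : measurable_fun setT D.
  rewrite (_ : D = fun x => G 0 0 x * (G 1 1 x * G 2 2 x - G 1 2 x * G 2 1 x)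
         - G 0 1 x * (G 1 0 x * G 2 2 x - G 1 2 x * G 2 0 x)
         + G 0 2 x * (G 1 0 x * G 2 1 x - G 1 1 x * G 2 0 x)); last first.
    by apply/funext => x; rewrite /D det3E !mxE.
  by apply: measurable_funD; [apply: measurable_funB|];
    apply: measurable_funM => //; apply: measurable_funB; exact:
        measurable_funM.
have ms : measurable_fun setT s.
  by apply: measurable_sum => i; exact: measurableT_comp.
have mrho1 : measurable_fun setT rho1.
  apply: measurable_maxr => //; apply: measurable_funM; first exact:
      measurable_funX.
  have m27 : measurable_fun setT (fun x => 27 * D x) by exact: measurable_funM.
  exact: (measurableT_comp (@measurable_powR R (-1)) m27).
have s0 x : 0 <= s x by rewrite sumr_ge0.
have rho10 x : 0 <= rho1 x by rewrite le_max lexx.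
have rho1_le : {ae leb3 R, forall x, cylinder R x ->
    rho1 x <= opnorm (Df x) ^+ 3 / \det (Df x)}.
  apply: (@ae_imp _ _ _ (prod_sf (leb2s R) (lebs R)) _ _ _ f_or) => x + cx.
  move=> /(_ cx) det0.
  have op0 : 0 <= opnorm (Df x) := le_trans (normr_ge0 _) (opnorm_ge_entry (Df
      x) 0 0).
  have [Bx|nBx] := pselect (B x); last first.
    rewrite /rho1 (_ : s x = 0) ?expr0n/= ?mul0r ?maxxx.
      by rewrite divr_ge0 ?exprn_ge0// ltW.
    by rewrite /s big1// => i _; rewrite /G patchE memNset// normr0.
  have det27 : 0 <= 27 * \det (Df x) by rewrite mulr_ge0// ltW.
  rewrite /rho1 DE// powR_inv1// ge_max divr_ge0 ?exprn_ge0 ?(ltW det0)//=.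
  rewrite invfM mulrA ler_wpM2r ?invr_ge0 ?(ltW det0)// ler_pdivrMr//.
  have s3 : s x <= 3 * opnorm (Df x).
    rewrite /s sum3E /G !patchE !mem_set//.
    have := opnorm_ge_entry (Df x) 0 2; have := opnorm_ge_entry (Df x) 1 2.
    by have := opnorm_ge_entry (Df x) 2 2; lra.
  have := lerXn2r 3 (s0 x) (mulr_ge0 (ler0n _ 3) op0) s3.
  by rewrite exprMn mulrC => /le_trans; apply; rewrite -natrX.
have irho1 : (leb3 R).-integrable setT (EFin \o rho1).
  apply: (@integrable_minorant _ _ _ (prod_sf (leb2s R) (lebs R)) (cylinder R)
    (fun x => opnorm (Df x) ^+ 3 / \det (Df x))) => //.
  move=> x nx; rewrite /rho1 (_ : s x = 0) ?expr0n/= ?mul0r ?maxxx//.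
  rewrite /s big1// => i _; rewrite /G patchE memNset ?normr0// => Bx.
  by apply: nx; exact: B_cyl.
(* The factor 27 cancels the one in [rho1], leaving s^3 <= rho D. *)
pose rho x := 27 * rho1 x.
have irho : (leb3 R).-integrable setT (EFin \o rho).
  have := @integrableZl _ _ _ (prod_sf (leb2s R) (lebs R)) setT measurableT 27
      _ irho1.
  exact: eq_integrable.
have det_rho : {ae leb3 R, forall x, B x ->
    0 < \det (\matrix_(i, j) G i j x) /\
    (\sum_(i < 3) `|G i 2 x|) ^+ 3 <= rho x * \det (\matrix_(i, j) G i j x)}.
  apply: (@ae_imp _ _ _ (prod_sf (leb2s R) (lebs R)) _ _ _ f_or) => x + Bx.
  move=> /(_ (B_cyl x Bx)); rewrite -/(D x) -/(s x) -DE// => D0; split=> //.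
  have : s x ^+ 3 * (27 * D x) `^ (-1) <= rho1 x by rewrite le_max lexx orbT.
  rewrite powR_inv1 ?mulr_ge0 ?(ltW D0)// ler_pdivrMr ?mulr_gt0// => /le_trans;
      apply.
  by rewrite /rho mulrCA mulrA.
have V2 : (forall q, Q q -> V 2 q != 0) \/ (forall z, W 2 z = 0).
  by case: hh0 => hh0; [left=> q Qq; rewrite /V (tnth_nth 0)/= hh0|right].
have [v_neq0|v_eq0] := v0.
  apply: (@box_contradiction R 0 b r1 d F G u (fun i => coord3 i p) W V k rho)
      => //.
  - by move=> x; rewrite /rho mulr_ge0.
  - move=> q /Q_polar[/v_neq0 vq _ _ _].
    rewrite /V !(tnth_nth 0)/= !mulf_eq0 (negbTE vq)/=.
    have := cos2Dsin2 (g (ang q)).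
    have [->|] := eqVneq (cos (g (ang q))) 0; last by left.
    rewrite expr0n/= add0r => s1; right; apply/eqP => s2.
    by move: s1; rewrite s2 expr0n/= => /esym/eqP; rewrite oner_eq0.
(* If [v] vanishes on ]r1, r2[, the first two components vanish on the box, against the positive
   determinant. *)
apply: (@profiles_not_zero R 0 b r1 d F G u (fun i => coord3 i p) W V rho) =>
    //.
by move=> q /Q_polar[/v_eq0 vq _ _ _]; rewrite /V !(tnth_nth 0)/= vq !mul0r.
Qed.
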